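(* Let $l\ge 1$ be an integer and let $\epsilon_{\mathrm b}\in\mathbb{C}\setminus(-\infty,0]$ with $\operatorname{Im}\epsilon_{\mathrm b}\ge 0$ be fixed. Let $f_l(\epsilon,z)$, analytic in $(\epsilon,z)\in\mathbb{C}\times\mathbb{C}$, be the denominator function defined in the context, so that the electric Mie coefficient of a homogeneous sphere of permittivity $\epsilon$ and electrical size $z=k_0a$ is $$r_{2l}=\frac{2l+1}{l}\,\frac{(\sqrt{\epsilon_{\mathrm b}})^{l+1}}{(\sqrt{\epsilon})^{l-1}}\,\frac{1}{f_l(\epsilon,k_0a)}.$$ Then there exist a function $\epsilon_{\mathrm p,l}(z)$, analytic in a neighborhood of $z=0$, with $$\epsilon_{\mathrm p,l}(0)=-\frac{l+1}{l}\epsilon_{\mathrm b},$$ and a function $A(\epsilon,z)$, analytic in a neighborhood of $\left(-\frac{l+1}{l}\epsilon_{\mathrm b},0\right)$, with $A(\epsilon,0)=1$, such that in a neighborhood of $\left(-\frac{l+1}{l}\epsilon_{\mathrm b},0\right)$ $$f_l(\epsilon,z)=A(\epsilon,z)\left(\epsilon-\epsilon_{\mathrm p,l}(z)\right),$$ and this factorization is unique. In particular, for small $k_0a$ there is a unique, simple pole $\epsilon=\epsilon_{\mathrm p,l}(k_0a)$ of $r_{2l}$ (that is, a unique, simple zero of $f_l(\cdot,k_0a)$) with the property $\epsilon_{\mathrm p,l}(k_0a)\to-\frac{l+1}{l}\epsilon_{\mathrm b}$ as $k_0a\to 0$.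
   Context: Square roots are principal. $\psi_l(z)=z\,\mathrm{j}_l(z)$ and $\xi_l(z)=z\,\mathrm{h}^{(1)}_l(z)$ are the Riccati-Bessel functions ($\mathrm{j}_l$ spherical Bessel, $\mathrm{h}_l^{(1)}$ spherical Hankel function of the first kind), primes denote derivatives with respect to the argument. With $x=z\sqrt{\epsilon}$ and $x_{\mathrm b}=z\sqrt{\epsilon_{\mathrm b}}$ (i.e. $x=ka$, $x_{\mathrm b}=k_{\mathrm b}a$ when $z=k_0a$), define $$f_l(\epsilon,z)=\frac{2l+1}{l}\left(\mathrm i\,x_{\mathrm b}^{l}\,\xi_l(x_{\mathrm b})\;x^{-l}\psi_l'(x)\,\epsilon_{\mathrm b}-\mathrm i\,x^{-l-1}\psi_l(x)\;x_{\mathrm b}^{l+1}\xi_l'(x_{\mathrm b})\,\epsilon\right).$$ The functions $x^{l}\xi_l(x)$, $x^{l+1}\xi_l'(x)$, $x^{-l}\psi_l'(x)$, $x^{-l-1}\psi_l(x)$ are entire, the last two being even, so $f_l$ is (after removing removable singularities) analytic in $(\epsilon,z)\in\mathbb{C}^2$. The coefficient $r_{2l}$ is the ratio of the interior to the incident electric multipole coefficient of order $l$ for a homogeneous sphere of radius $a$, $$r_{2l}=\frac{-\mathrm i\,m}{\xi_l(k_{\mathrm b}a)\psi_l'(ka)-m\,\psi_l(ka)\xi_l'(k_{\mathrm b}a)},\qquad m=\frac{\sqrt{\epsilon}}{\sqrt{\epsilon_{\mathrm b}}},\quad k=k_0\sqrt{\epsilon},\quad k_{\mathrm b}=k_0\sqrt{\epsilon_{\mathrm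 b}} .$$ *)

(* Defs.v *)
From Stdlib Require Import Reals Factorial.
From Coquelicot Require Import Coquelicot.
Open Scope C_scope.

(* Principal square root: argument in (-pi/2, pi/2], branch cut (-oo, 0],
   continuous from above on the cut. *)
Definition Csqrt (z : C) : C :=
  (sqrt ((Cmod z + Re z) / 2),
   if Rlt_dec (Im z) 0 then (- sqrt ((Cmod z - Re z) / 2))%R
   else sqrt ((Cmod z - Re z) / 2)).

(* Sum of a convergent complex series, componentwise as in [C_lim]. *)
Definition CSeries (a : nat -> C) : C :=
  (Series (fun n => Re (a n)), Series (fun n => Im (a n))).

(* [odd_fact n] is the double factorial (2n-1)!!, with (-1)!! = 1. *)
Fixpoint odd_fact (n : nat) : nat :=
  match n with
  | O => 1
  | S p => (2 * p + 1) * odd_fact p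
  end.

(* Spherical Bessel functions j_l(z) = sqrt(pi/(2z)) J_{l+1/2}(z) and
   y_l(z) = sqrt(pi/(2z)) Y_{l+1/2}(z) through their ascending series
   (DLMF 10.53.1 and 10.53.2); the infinite part of y_l is reindexed by
   k = l + 1 + j. *)
Definition sph_j (l : nat) (z : C) : C :=
  z ^ l *
  CSeries (fun k =>
    (- (z ^ 2 / 2)) ^ k / (INR (fact k) * INR (odd_fact (l + k + 1)))).

Definition sph_y (l : nat) (z : C) : C :=
  - / z ^ (l + 1) *
    sum_n (fun k => INR (odd_fact (l - k)) * (z ^ 2 / 2) ^ k / INR (fact k)) l
  + (-1) ^ (l + 1) / z ^ (l + 1) *
    CSeries (fun j =>
      (- (z ^ 2 / 2)) ^ (l + 1 + j)
      / (INR (fact (l + 1 + j)) * INR (odd_fact (j + 1)))).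

Definition sph_h1 (l : nat) (z : C) : C := sph_j l z + Ci * sph_y l z.

(* Riccati-Bessel functions. *)
Definition psi (l : nat) (z : C) : C := z * sph_j l z.
Definition xi (l : nat) (z : C) : C := z * sph_h1 l z.

(* [g] with its removable singularity at 0 removed. *)
Definition remove_sing0 (g : C -> C) (w : C) : C :=
  if Ceq_dec w 0 then C_lim g 0 else g w.

(* The denominator function f_l(eps, z); [eb] is the background permittivity. *)
Definition mie_f (l : nat) (eb eps z : C) : C :=
  let x := z * Csqrt eps in
  let xb := z * Csqrt eb in
  (2 * INR l + 1) / INR l *
  (Ci * remove_sing0 (fun w => w ^ l * xi l w) xb
      * remove_sing0 (fun w => C_derive (psi l) w / w ^ l) x * eb
   - Ci * remove_sing0 (fun w => psi l w / w ^ (l + 1)) x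
        * remove_sing0 (fun w => w ^ (l + 1) * C_derive (xi l) w) xb * eps).

(* The electric Mie coefficient r_{2l} as a function of eps and z = k0 a. *)
Definition mie_r2 (l : nat) (eb eps z : C) : C :=
  let m := Csqrt eps / Csqrt eb in
  let x := z * Csqrt eps in
  let xb := z * Csqrt eb in
  - Ci * m /
  (xi l xb * C_derive (psi l) x - m * psi l x * C_derive (xi l) xb).

(* The quasi-static resonance -(l+1)/l * eb. *)
Definition eps_res (l : nat) (eb : C) : C := - ((INR l + 1) / INR l * eb).

(* Analyticity: local expansion in a convergent power series. *)
Definition analytic_at (g : C -> C) (z0 : C) : Prop :=
  exists (a : nat -> C) (r : posreal),
    forall z : C, Cmod (z - z0) < r -> is_pseries a (z - z0) (g z).

(* In two variables the double power series converges absolutely on a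
   polydisc, so the choice of partial sums is immaterial. *)
Definition analytic2_at (F : C -> C -> C) (u0 v0 : C) : Prop :=
  exists (a : nat -> nat -> C) (r : posreal),
    (exists M : R, forall N : nat,
       sum_n (fun m => sum_n (fun n => Cmod (a m n) * r ^ (m + n)) N) N <= M)%R
    /\
    (forall u v : C, Cmod (u - u0) < r -> Cmod (v - v0) < r ->
       filterlim
         (fun N : nat =>
            sum_n (fun m => sum_n (fun n =>
              a m n * (u - u0) ^ m * (v - v0) ^ n) N) N)
         eventually (locally (F u v))).

Definition simple_zero (g : C -> C) (p : C) : Prop :=
  g p = 0 /\ exists d : C, is_derive g p d /\ d <> 0.

Definition simple_pole (g : C -> C) (p : C) : Prop :=
  exists h : C -> C,
    analytic_at h p /\ h p <> 0 /\
    locally' p (fun e => g e = h e / (e - p)).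

Definition near2 (u0 v0 : C) (P : C -> C -> Prop) : Prop :=
  locally ((u0, v0) : C * C) (fun p => P (fst p) (snd p)).

(* [ep] and [A] matter only as germs at 0 and at (eps_res l eb, 0). *)
Definition mie_factorization
    (l : nat) (eb : C) (ep : C -> C) (A : C -> C -> C) : Prop :=
  let e0 := eps_res l eb in
  locally (0 : C) (fun z => analytic_at ep z) /\
  ep 0 = e0 /\
  near2 e0 0 (fun e z => analytic2_at A e z) /\
  locally e0 (fun e => A e 0 = 1) /\
  near2 e0 0 (fun e z => mie_f l eb e z = A e z * (e - ep z)).

(* Main.v *)
Require Import Defs.
From Stdlib Require Import Reals Factorial Lra Lia IndefiniteDescription.
From Coquelicot Require Import Coquelicot.
Open Scope C_scope.

(* The double power series of finite weighted l^1 norm on a closed bidisc form a Banach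
   algebra closed under composition, and analyticity is handled through estimates in it.
   Since f_l(eps, 0) = eps - e0, writing u = eps - e0 one has f_l = u + z K(u, z), and
   u = - z K(u, z) is solved by a contraction, which gives e_p(z) = e0 + g(z).  The
   expansion of f_l(e_p(z) + w, z) around w = 0 has no constant term in w; dividing it by
   w and substituting w = eps - e_p(z) gives A.  As A(e0, 0) = 1, 1 / A is a geometric
   series in the algebra, and r_{2l} inherits its simple pole. *)

(* [ring] and [field] need the equality to be typed in [C] itself, not in one of
   its Coquelicot structures. *)
Ltac cring := match goal with |- ?a = ?b => change (@eq C a b) end; ring.
Ltac cfield := match goal with |- ?a = ?b => change (@eq C a b) end; field.

(** * Absolutely convergent double series *)

(** Analyticity has to survive products, compositions, quotients and a fixed point, and one number
    controls all of them. The l^1 norm is submultiplicative and dominates the supremum, so an inner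
    function may be substituted once its norm is at most the outer radius, and a series of functions
    converges in the algebra once its norms are summable. No Cauchy integral and no coefficient
    formula for products enters. The definition of [mie_f] resists this in two ways: it contains
    limits at removable singularities and the discontinuous root of eps. The functions of x involved
    are even, so only x^2 = z^2 eps survives, and each limit becomes the value of an explicit entire
    function. That f_l(eps, 0) is exactly eps - e0 comes from j_l(x) ~ x^l / (2l+1)!! and y_l(x) ~
    -(2l-1)!! / x^(l+1): the double factorials leave 1 / (2l+1), which the prefactor (2l+1) / l
    compensates. The root returns only in r_{2l}, through sqrt(eps)^(l-1), which is why the pole is
    read off after multiplying by that factor. *)

Lemma csum_Sn (f : nat -> C) n : sum_n f (S n) = sum_n f n + f (S n).
Proof. exact (sum_Sn f n). Qed.

Lemma rsum_Sn (f : nat -> R) n : sum_n f (S n) = (sum_n f n + f (S n))%R.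
Proof. exact (sum_Sn f n). Qed.

Lemma csum_O (f : nat -> C) : sum_n f 0 = f O.
Proof. exact (sum_O f). Qed.

Lemma rsum_O (f : nat -> R) : sum_n f 0 = f O.
Proof. exact (sum_O f). Qed.

Lemma csum_plus (f g : nat -> C) n :
  sum_n (fun k => f k + g k) n = sum_n f n + sum_n g n.
Proof. exact (sum_n_plus f g n). Qed.

Lemma csum_mult_l (c : C) (f : nat -> C) n :
  sum_n (fun k => c * f k) n = c * sum_n f n.
Proof. exact (sum_n_mult_l (K := C_Ring) c f n). Qed.

Lemma rsum_mult_l (c : R) (f : nat -> R) n :
  sum_n (fun k => (c * f k)%R) n = (c * sum_n f n)%R.
Proof. exact (sum_n_mult_l (K := R_Ring) c f n). Qed.

Lemma rsum_plus (f g : nat -> R) n :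
  sum_n (fun k => (f k + g k)%R) n = (sum_n f n + sum_n g n)%R.
Proof. exact (sum_n_plus f g n). Qed.

Lemma csum_0 n : sum_n (fun _ => RtoC 0) n = RtoC 0.
Proof.
  induction n as [|n IH]; [apply csum_O|rewrite csum_Sn, IH; cring].
Qed.

Lemma rsum_le (f g : nat -> R) n :
  (forall k, (k <= n)%nat -> (f k <= g k)%R) -> (sum_n f n <= sum_n g n)%R.
Proof.
  induction n as [|n IH]; intros H.
  - rewrite !rsum_O. apply H. lia.
  - rewrite !rsum_Sn. apply Rplus_le_compat; [apply IH; intros; apply H|apply H]; lia.
Qed.

Lemma Cmod_sum_le (f : nat -> C) n :
  (Cmod (sum_n f n) <= sum_n (fun k => Cmod (f k)) n)%R.
Proof.
  induction n as [|n IH].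
  - rewrite csum_O, rsum_O. lra.
  - rewrite csum_Sn, rsum_Sn. eapply Rle_trans; [apply Cmod_triangle|lra].
Qed.

Lemma rsum_nonneg (f : nat -> R) n :
  (forall k, (k <= n)%nat -> (0 <= f k)%R) -> (0 <= sum_n f n)%R.
Proof.
  induction n as [|n IH]; intros H.
  - rewrite rsum_O. apply H. lia.
  - rewrite rsum_Sn. apply Rplus_le_le_0_compat; [apply IH; intros; apply H|apply H]; lia.
Qed.

Lemma rsum_mono (f : nat -> R) n m :
  (forall k, (0 <= f k)%R) -> (n <= m)%nat -> (sum_n f n <= sum_n f m)%R.
Proof.
  intros H. induction 1 as [|m _ IH]; [lra|].
  rewrite rsum_Sn. specialize (H (S m)). lra.
Qed.

Lemma Cmod_sub_le (x y z : C) : (Cmod (x - z) <= Cmod (x - y) + Cmod (y - z))%R.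
Proof. replace (x - z) with ((x - y) + (y - z)) by cring. apply Cmod_triangle. Qed.

Lemma Cmod_sub_sym (x y : C) : Cmod (x - y) = Cmod (y - x).
Proof. replace (x - y) with (- (y - x)) by cring. apply Cmod_opp. Qed.

Definition dsum (f : nat -> nat -> C) (M N : nat) : C :=
  sum_n (fun m => sum_n (f m) N) M.

Definition dabs (f : nat -> nat -> C) (M N : nat) : R :=
  sum_n (fun m => sum_n (fun n => Cmod (f m n)) N) M.

(** The two truncation indices are independent, so shifting one index and exchanging the two
    preserve the limit at once. The square sums of [analytic2_at] are the case M = N. *)
Definition dlim (f : nat -> nat -> C) (l : C) : Prop :=
  forall eps : R, (0 < eps)%R -> exists N0 : nat, forall M N : nat,
    (N0 <= M)%nat -> (N0 <= N)%nat -> (Cmod (dsum f M N - l) < eps)%R.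

Lemma dabs_SM f M N :
  dabs f (S M) N = (dabs f M N + sum_n (fun n => Cmod (f (S M) n)) N)%R.
Proof. apply rsum_Sn. Qed.

Lemma dabs_SN f M N :
  dabs f M (S N) = (dabs f M N + sum_n (fun m => Cmod (f m (S N))) M)%R.
Proof.
  unfold dabs. rewrite <- rsum_plus. apply sum_n_ext. intros m. apply rsum_Sn.
Qed.

Lemma dsum_SM f M N : dsum f (S M) N = dsum f M N + sum_n (f (S M)) N.
Proof. apply csum_Sn. Qed.

Lemma dsum_SN f M N : dsum f M (S N) = dsum f M N + sum_n (fun m => f m (S N)) M.
Proof.
  unfold dsum. rewrite <- csum_plus. apply sum_n_ext. intros m. apply csum_Sn.
Qed.

(** The larger rectangle is reached one row or one column at a time, and each added strip is bounded
    by its own absolute sum. *)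
Lemma dsum_tail f M N M' N' : (M <= M')%nat -> (N <= N')%nat ->
  (Cmod (dsum f M' N' - dsum f M N) <= dabs f M' N' - dabs f M N)%R.
Proof.
  intros HM HN. induction HM as [|M' HM IH].
  - induction HN as [|N' HN IH].
    + replace (dsum f M N - dsum f M N) with (RtoC 0) by cring. rewrite Cmod_0. lra.
    + rewrite dsum_SN, dabs_SN.
      assert (H := Cmod_sum_le (fun m => f m (S N')) M).
      replace (dsum f M N' + sum_n (fun m => f m (S N')) M - dsum f M N)
        with ((dsum f M N' - dsum f M N) + sum_n (fun m => f m (S N')) M) by cring.
      eapply Rle_trans; [apply Cmod_triangle|]. lra.
  - rewrite dsum_SM, dabs_SM.
    assert (H := Cmod_sum_le (f (S M')) N').
    replace (dsum f M' N' + sum_n (f (S M')) N' - dsum f M N)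
      with ((dsum f M' N' - dsum f M N) + sum_n (f (S M')) N') by cring.
    eapply Rle_trans; [apply Cmod_triangle|]. lra.
Qed.

Lemma dabs_mono f M N M' N' : (M <= M')%nat -> (N <= N')%nat ->
  (dabs f M N <= dabs f M' N')%R.
Proof.
  intros HM HN. assert (H := dsum_tail f _ _ _ _ HM HN).
  assert (H' := Cmod_ge_0 (dsum f M' N' - dsum f M N)). lra.
Qed.

Lemma dabs_nonneg f M N : (0 <= dabs f M N)%R.
Proof.
  apply rsum_nonneg. intros. apply rsum_nonneg. intros. apply Cmod_ge_0.
Qed.

Lemma dsum_le_dabs f M N : (Cmod (dsum f M N) <= dabs f M N)%R.
Proof.
  unfold dsum, dabs. eapply Rle_trans; [apply Cmod_sum_le|].
  apply rsum_le. intros. apply Cmod_sum_le.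
Qed.

Lemma term_le_dabs f m n M N : (m <= M)%nat -> (n <= N)%nat ->
  (Cmod (f m n) <= dabs f M N)%R.
Proof.
  intros Hm Hn.
  apply Rle_trans with (dabs f m n); [|now apply dabs_mono].
  assert (H1 : (Cmod (f m n) <= sum_n (fun n => Cmod (f m n)) n)%R).
  { destruct n; [rewrite rsum_O; lra|]. rewrite rsum_Sn.
    assert (0 <= sum_n (fun n => Cmod (f m n)) n)%R
      by (apply rsum_nonneg; intros; apply Cmod_ge_0). lra. }
  destruct m; [unfold dabs; rewrite rsum_O; exact H1|].
  rewrite dabs_SM. assert (H := dabs_nonneg f m n). lra.
Qed.

Lemma dlim_unique f l l' : dlim f l -> dlim f l' -> l = l'.
Proof.
  intros H H'. destruct (Ceq_dec l l') as [E|E]; [exact E|exfalso].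
  assert (Hp : (0 < Cmod (l - l'))%R).
  { apply Cmod_gt_0. intros E'. apply E. replace l with (l - l' + l') by cring.
    rewrite E'. cring. }
  destruct (H (Cmod (l - l') / 2)%R ltac:(lra)) as [N1 H1].
  destruct (H' (Cmod (l - l') / 2)%R ltac:(lra)) as [N2 H2].
  specialize (H1 (max N1 N2) (max N1 N2) ltac:(lia) ltac:(lia)).
  specialize (H2 (max N1 N2) (max N1 N2) ltac:(lia) ltac:(lia)).
  assert (T := Cmod_sub_le l (dsum f (max N1 N2) (max N1 N2)) l').
  rewrite (Cmod_sub_sym l (dsum _ _ _)) in T. lra.
Qed.

Lemma dlim_ext f g l : (forall m n, f m n = g m n) -> dlim f l -> dlim g l.
Proof.
  intros E H eps He. destruct (H eps He) as [N0 HN]. exists N0. intros M N HM Hn.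
  replace (dsum g M N) with (dsum f M N); [auto|].
  apply sum_n_ext. intros m. apply sum_n_ext. intros n. apply E.
Qed.

Lemma dsum_plus f g M N :
  dsum (fun m n => f m n + g m n) M N = dsum f M N + dsum g M N.
Proof.
  unfold dsum. rewrite <- csum_plus. apply sum_n_ext. intros m. apply csum_plus.
Qed.

Lemma dlim_plus f g l l' : dlim f l -> dlim g l' ->
  dlim (fun m n => f m n + g m n) (l + l').
Proof.
  intros H H' eps He.
  destruct (H (eps / 2)%R ltac:(lra)) as [N1 H1].
  destruct (H' (eps / 2)%R ltac:(lra)) as [N2 H2].
  exists (max N1 N2). intros M N HM HN.
  specialize (H1 M N ltac:(lia) ltac:(lia)). specialize (H2 M N ltac:(lia) ltac:(lia)).
  rewrite dsum_plus.
  replace (dsum f M N + dsum g M N - (l + l'))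
    with ((dsum f M N - l) + (dsum g M N - l')) by cring.
  eapply Rle_lt_trans; [apply Cmod_triangle|lra].
Qed.

Lemma dlim_sum (f : nat -> nat -> nat -> C) (l : nat -> C) n :
  (forall k, (k <= n)%nat -> dlim (f k) (l k)) ->
  dlim (fun i j => sum_n (fun k => f k i j) n) (sum_n l n).
Proof.
  induction n as [|n IH]; intros H.
  - rewrite csum_O. eapply dlim_ext; [|apply (H O); lia].
    intros. now rewrite csum_O.
  - rewrite csum_Sn.
    eapply dlim_ext; [|apply dlim_plus; [apply IH; intros; apply H; lia|apply (H (S n)); lia]].
    intros. cbv beta. now rewrite csum_Sn.
Qed.

Lemma dsum_scal c f M N : dsum (fun m n => c * f m n) M N = c * dsum f M N.
Proof.
  unfold dsum. rewrite <- csum_mult_l. apply sum_n_ext. intros. apply csum_mult_l.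
Qed.

Lemma dlim_scal c f l : dlim f l -> dlim (fun m n => c * f m n) (c * l).
Proof.
  intros H eps He.
  assert (Hc := Cmod_ge_0 c).
  destruct (H (eps / (Cmod c + 1))%R) as [N0 HN]; [apply Rdiv_lt_0_compat; lra|].
  exists N0. intros M N HM Hn. specialize (HN M N HM Hn).
  rewrite dsum_scal. replace (c * dsum f M N - c * l) with (c * (dsum f M N - l)) by cring.
  rewrite Cmod_mult.
  assert (E : (eps = (Cmod c + 1) * (eps / (Cmod c + 1)))%R) by (field; lra).
  assert (H' := Cmod_ge_0 (dsum f M N - l)).
  rewrite E. nra.
Qed.

(** The bound [B0] is lowered to the least one, because only for the supremum does B minus a partial
    absolute sum tend to 0 and so serve as a tail estimate. *)
Lemma dabs_sup f B0 : (forall M N, (dabs f M N <= B0)%R) ->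
  exists B, (B <= B0)%R /\ (forall M N, (dabs f M N <= B)%R) /\
    forall eps, (0 < eps)%R -> exists N0, (B - eps < dabs f N0 N0)%R.
Proof.
  intros H.
  destruct (completeness (fun x => exists M N, x = dabs f M N)) as [B [HB1 HB2]].
  - exists B0. intros x (M & N & ->). apply H.
  - exists (dabs f 0 0), 0%nat, 0%nat. reflexivity.
  - exists B. split; [|split].
    + apply HB2. intros x (M & N & ->). apply H.
    + intros M N. apply HB1. now exists M, N.
    + intros eps He. apply Classical_Prop.NNPP. intros Hn.
      assert (B <= B - eps)%R; [|lra].
      apply HB2. intros x (M & N & ->). apply Rnot_lt_le. intros Hlt. apply Hn.
      exists (max M N). eapply Rlt_le_trans; [exact Hlt|]. apply dabs_mono; lia.
Qed.

Lemma dlim_tail f l B M N : (forall M N, (dabs f M N <= B)%R) -> dlim f l ->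
  (Cmod (l - dsum f M N) <= B - dabs f M N)%R.
Proof.
  intros HB Hl. apply Rle_plus_epsilon. intros eps He.
  destruct (Hl eps He) as [N0 HN].
  specialize (HN (max M N0) (max N N0) ltac:(lia) ltac:(lia)).
  assert (T := Cmod_sub_le l (dsum f (max M N0) (max N N0)) (dsum f M N)).
  rewrite (Cmod_sub_sym l (dsum f (max M N0) _)) in T.
  assert (T' := dsum_tail f M N (max M N0) (max N N0) ltac:(lia) ltac:(lia)).
  specialize (HB (max M N0) (max N N0)). lra.
Qed.

(** Absolute convergence makes the square sums a Cauchy sequence, whose limit is taken in each real
    component; [Hs] then carries it to all large rectangles. *)
Lemma dlim_ex f B : (forall M N, (dabs f M N <= B)%R) -> exists l, dlim f l.
Proof.
  intros HB0. destruct (dabs_sup f B HB0) as (B' & _ & HB & HS).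
  set (s := fun N => dsum f N N).
  assert (Hs : forall eps, (0 < eps)%R -> exists N0, forall M N, (N0 <= M)%nat ->
    (N0 <= N)%nat -> (Cmod (dsum f M N - s N0) < eps)%R).
  { intros eps He. destruct (HS eps He) as [N0 HN0]. exists N0. intros M N HM HN.
    assert (T := dsum_tail f N0 N0 M N HM HN). specialize (HB M N). unfold s. lra. }
  assert (Hre : ex_lim_seq_cauchy (fun N => Re (s N))).
  { intros eps. destruct (Hs (eps / 2)%R) as [N0 H]; [apply is_pos_div_2|].
    exists N0. intros n m Hn Hm.
    assert (H1 := H n n Hn Hn). assert (H2 := H m m Hm Hm). fold (s n) in H1. fold (s m) in H2.
    assert (T := Cmod_sub_le (s n) (s N0) (s m)). rewrite (Cmod_sub_sym (s N0) (s m)) in T.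
    assert (R' := re_le_Cmod (s n - s m)).
    change (Re (s n - s m)) with (Re (s n) - Re (s m))%R in R'. lra. }
  assert (Him : ex_lim_seq_cauchy (fun N => Im (s N))).
  { intros eps. destruct (Hs (eps / 2)%R) as [N0 H]; [apply is_pos_div_2|].
    exists N0. intros n m Hn Hm.
    assert (H1 := H n n Hn Hn). assert (H2 := H m m Hm Hm). fold (s n) in H1. fold (s m) in H2.
    assert (T := Cmod_sub_le (s n) (s N0) (s m)). rewrite (Cmod_sub_sym (s N0) (s m)) in T.
    assert (R' := Rmax_Cmod (s n - s m)).
    assert (R'' := Rmax_r (Rabs (fst (s n - s m))) (Rabs (snd (s n - s m)))).
    change (snd (s n - s m)) with (Im (s n) - Im (s m))%R in R', R''.
    lra. }
  apply ex_lim_seq_cauchy_corr in Hre. apply ex_lim_seq_cauchy_corr in Him.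
  destruct Hre as [lr Hlr], Him as [li Hli].
  exists (lr, li). intros eps He.
  apply is_lim_seq_spec in Hlr. apply is_lim_seq_spec in Hli.
  assert (He4 : (0 < eps / 4)%R) by lra.
  destruct (Hlr (mkposreal _ He4)) as [N1 H1]. destruct (Hli (mkposreal _ He4)) as [N2 H2].
  destruct (Hs (eps / 4)%R He4) as [N0 HN0]. simpl in H1, H2.
  exists N0. intros M N HM HN.
  set (K := max N0 (max N1 N2)).
  specialize (H1 K ltac:(lia)). specialize (H2 K ltac:(lia)).
  assert (H3 := HN0 K K ltac:(lia) ltac:(lia)). fold (s K) in H3.
  specialize (HN0 M N HM HN).
  assert (T := Cmod_sub_le (dsum f M N) (s N0) (lr, li)).
  assert (T2 := Cmod_sub_le (s N0) (s K) (lr, li)). rewrite (Cmod_sub_sym (s N0) (s K)) in T2.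
  assert (T3 := Cmod_2Rmax (s K - (lr, li))).
  change (fst (s K - (lr, li))) with (Re (s K) - lr)%R in T3.
  change (snd (s K - (lr, li))) with (Im (s K) - li)%R in T3.
  assert (Q : (sqrt 2 <= 2)%R).
  { rewrite <- (sqrt_square 2) at 2 by lra. apply sqrt_le_1; lra. }
  assert (Q' : (Rmax (Rabs (Re (s K) - lr)) (Rabs (Im (s K) - li)) < eps / 4)%R)
    by (apply Rmax_lub_lt; assumption).
  assert (Q'' := Rabs_pos (Re (s K) - lr)).
  assert (Q3 := Rmax_l (Rabs (Re (s K) - lr)) (Rabs (Im (s K) - li))).
  assert (sqrt 2 * Rmax (Rabs (Re (s K) - lr)) (Rabs (Im (s K) - li)) < 2 * (eps / 4))%R by nra.
  lra.
Qed.

(** * Comparison, shift and transposition of double sums *)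

Lemma csum_shift (f : nat -> C) n :
  sum_n f (S n) = f O + sum_n (fun k => f (S k)) n.
Proof.
  induction n as [|n IH].
  - rewrite csum_Sn, !csum_O. reflexivity.
  - rewrite csum_Sn, IH, csum_Sn. cring.
Qed.

Lemma rsum_shift (f : nat -> R) n :
  (sum_n f (S n) = f O + sum_n (fun k => f (S k)) n)%R.
Proof.
  induction n as [|n IH].
  - rewrite rsum_Sn, !rsum_O. reflexivity.
  - rewrite rsum_Sn, IH, rsum_Sn. lra.
Qed.

Lemma rsum_zero (f : nat -> R) n : (forall k, f k = 0%R) -> sum_n f n = 0%R.
Proof.
  intros H. rewrite (sum_n_ext f (fun _ => (0 * 0)%R)) by (intros; rewrite H; lra).
  rewrite rsum_mult_l. lra.
Qed.

Lemma dabs_ext f g M N : (forall m n, f m n = g m n) -> dabs f M N = dabs g M N.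
Proof.
  intros E. apply sum_n_ext. intros m. apply sum_n_ext. intros n. now rewrite E.
Qed.

Lemma dsum_ext f g M N : (forall m n, f m n = g m n) -> dsum f M N = dsum g M N.
Proof.
  intros E. apply sum_n_ext. intros m. apply sum_n_ext. intros n. now rewrite E.
Qed.

Lemma dabs_le c f g M N : (0 <= c)%R ->
  (forall m n, (Cmod (f m n) <= c * Cmod (g m n))%R) ->
  (dabs f M N <= c * dabs g M N)%R.
Proof.
  intros Hc H. unfold dabs. rewrite <- rsum_mult_l. apply rsum_le. intros m _.
  rewrite <- rsum_mult_l. apply rsum_le. intros n _. apply H.
Qed.

Lemma dabs_le1 f g M N : (forall m n, (Cmod (f m n) <= Cmod (g m n))%R) ->
  (dabs f M N <= dabs g M N)%R.
Proof.
  intros H. rewrite <- (Rmult_1_l (dabs g M N)). apply dabs_le; [lra|].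
  intros. rewrite Rmult_1_l. apply H.
Qed.

Lemma dabs_diff_le f g M N M' N' : (M <= M')%nat -> (N <= N')%nat ->
  (forall m n, (Cmod (f m n) <= Cmod (g m n))%R) ->
  (dabs f M' N' - dabs f M N <= dabs g M' N' - dabs g M N)%R.
Proof.
  intros HM HN H. induction HM as [|M' HM IH].
  - induction HN as [|N' HN IH]; [lra|].
    rewrite !dabs_SN.
    assert (sum_n (fun m => Cmod (f m (S N'))) M <= sum_n (fun m => Cmod (g m (S N'))) M)%R
      by (apply rsum_le; intros; apply H). lra.
  - rewrite !dabs_SM.
    assert (sum_n (fun n => Cmod (f (S M') n)) N' <= sum_n (fun n => Cmod (g (S M') n)) N')%R
      by (apply rsum_le; intros; apply H). lra.
Qed.

Lemma dlim_bound f l B : (forall M N, (dabs f M N <= B)%R) -> dlim f l -> (Cmod l <= B)%R.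
Proof.
  intros HB Hl. assert (T := dlim_tail f l B 0 0 HB Hl).
  assert (T2 := dsum_le_dabs f 0 0).
  replace l with ((l - dsum f 0 0) + dsum f 0 0) by cring.
  eapply Rle_trans; [apply Cmod_triangle|lra].
Qed.

(** The right-hand side involves only the dominating series [g], so the estimate is uniform over all
    [f] below it; the interchange of limits in [rep_dsum] needs this uniformity. *)
Lemma dlim_tail_dom f g l B M N : (forall m n, (Cmod (f m n) <= Cmod (g m n))%R) ->
  (forall M N, (dabs g M N <= B)%R) -> dlim f l ->
  (Cmod (l - dsum f M N) <= B - dabs g M N)%R.
Proof.
  intros Hfg HB Hl. apply Rle_plus_epsilon. intros eps He.
  destruct (Hl eps He) as [N0 HN].
  specialize (HN (max M N0) (max N N0) ltac:(lia) ltac:(lia)).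
  assert (T := Cmod_sub_le l (dsum f (max M N0) (max N N0)) (dsum f M N)).
  rewrite (Cmod_sub_sym l (dsum f (max M N0) _)) in T.
  assert (T' := dsum_tail f M N (max M N0) (max N N0) ltac:(lia) ltac:(lia)).
  assert (T2 := dabs_diff_le f g M N (max M N0) (max N N0) ltac:(lia) ltac:(lia) Hfg).
  specialize (HB (max M N0) (max N N0)). lra.
Qed.

Lemma dsum_sum (f : nat -> nat -> nat -> C) M N K :
  dsum (fun m n => sum_n (fun k => f k m n) K) M N = sum_n (fun k => dsum (f k) M N) K.
Proof.
  induction K as [|K IH].
  - rewrite csum_O. apply dsum_ext. intros. apply csum_O.
  - rewrite csum_Sn, <- IH, <- dsum_plus. apply dsum_ext. intros. apply csum_Sn.
Qed.

Lemma dlim_dsum (a : nat -> nat -> nat -> nat -> C) (b : nat -> nat -> C) M N :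
  (forall m n, dlim (fun k l => a k l m n) (b m n)) ->
  dlim (fun k l => dsum (a k l) M N) (dsum b M N).
Proof.
  intros H. apply (dlim_sum (fun m k l => sum_n (a k l m) N)). intros m _.
  apply (dlim_sum (fun n k l => a k l m n)). intros n _. apply H.
Qed.

(** Applied to coefficients this is multiplication by the first variable; applied to terms it undoes
    the removal of row 0 in [rep_divide_u]. *)
Definition rshift (f : nat -> nat -> C) (m n : nat) : C :=
  match m with O => 0 | S m' => f m' n end.

Lemma dsum_rshift f M N : dsum (rshift f) (S M) N = dsum f M N.
Proof.
  unfold dsum. rewrite csum_shift. simpl.
  assert (E : sum_n (rshift f 0) N = RtoC 0) by apply csum_0. rewrite E.
  apply Cplus_0_l.
Qed.

Lemma dabs_rshift f M N : dabs (rshift f) (S M) N = dabs f M N.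
Proof.
  unfold dabs. rewrite rsum_shift. simpl.
  rewrite rsum_zero by (intros; apply Cmod_0). lra.
Qed.

Lemma dabs_rshift_le f M N : (dabs (rshift f) M N <= dabs f M N)%R.
Proof.
  rewrite <- (dabs_rshift f M N). apply dabs_mono; lia.
Qed.

Lemma dlim_rshift f l : dlim f l -> dlim (rshift f) l.
Proof.
  intros H eps He. destruct (H eps He) as [N0 HN]. exists (S N0). intros M N HM Hn.
  destruct M as [|M]; [lia|]. rewrite dsum_rshift. apply HN; lia.
Qed.

Lemma dsum_swap f M N : dsum (fun m n => f n m) M N = dsum f N M.
Proof. apply (sum_n_switch (fun m n => f n m)). Qed.

Lemma dabs_swap f M N : dabs (fun m n => f n m) M N = dabs f N M.
Proof. apply (sum_n_switch (fun m n => Cmod (f n m))). Qed.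

Lemma dlim_swap f l : dlim f l -> dlim (fun m n => f n m) l.
Proof.
  intros H eps He. destruct (H eps He) as [N0 HN]. exists N0. intros M N HM Hn.
  rewrite dsum_swap. now apply HN.
Qed.

(** * The algebra of double power series *)

Definition mono (a : nat -> nat -> C) (u v : C) (m n : nat) : C := a m n * u ^ m * v ^ n.

(* The bidisc is closed, so that composition needs no loss of radius. *)
Definition rep (r s B : R) (F : C -> C -> C) : Prop :=
  exists a : nat -> nat -> C,
    (forall M N, (dabs (mono a r s) M N <= B)%R) /\
    forall u v, (Cmod u <= r)%R -> (Cmod v <= s)%R -> dlim (mono a u v) (F u v).

Lemma Cmod_RtoC_pos x : (0 <= x)%R -> Cmod (RtoC x) = x.
Proof. intros. rewrite Cmod_R. now apply Rabs_pos_eq. Qed.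

Lemma Cmod_mono a u v m n :
  Cmod (mono a u v m n) = (Cmod (a m n) * Cmod u ^ m * Cmod v ^ n)%R.
Proof. unfold mono. now rewrite !Cmod_mult, !Cmod_pow. Qed.

Lemma Cmod_mono_pos a r s m n : (0 <= r)%R -> (0 <= s)%R ->
  Cmod (mono a r s m n) = (Cmod (a m n) * r ^ m * s ^ n)%R.
Proof. intros. rewrite Cmod_mono, !Cmod_RtoC_pos; auto. Qed.

Lemma Cmod_mono_le a u v u' v' m n :
  (Cmod u <= Cmod u')%R -> (Cmod v <= Cmod v')%R ->
  (Cmod (mono a u v m n) <= Cmod (mono a u' v' m n))%R.
Proof.
  intros Hu Hv. rewrite !Cmod_mono.
  assert (0 <= Cmod u ^ m <= Cmod u' ^ m)%R
    by (split; [apply pow_le, Cmod_ge_0|apply pow_incr; split; auto; apply Cmod_ge_0]).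
  assert (0 <= Cmod v ^ n <= Cmod v' ^ n)%R
    by (split; [apply pow_le, Cmod_ge_0|apply pow_incr; split; auto; apply Cmod_ge_0]).
  assert (H1 := Cmod_ge_0 (a m n)).
  apply Rmult_le_compat; [nra|lra| |lra]. nra.
Qed.

Lemma dabs_mono_le a u v r s M N : (Cmod u <= r)%R -> (Cmod v <= s)%R ->
  (dabs (mono a u v) M N <= dabs (mono a r s) M N)%R.
Proof.
  intros Hu Hv. apply dabs_le1. intros. apply Cmod_mono_le.
  - rewrite Cmod_RtoC_pos; auto. eapply Rle_trans; [apply Cmod_ge_0|exact Hu].
  - rewrite Cmod_RtoC_pos; auto. eapply Rle_trans; [apply Cmod_ge_0|exact Hv].
Qed.

Lemma rep_bound r s B F u v : rep r s B F -> (Cmod u <= r)%R -> (Cmod v <= s)%R ->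
  (Cmod (F u v) <= B)%R.
Proof.
  intros (a & H1 & H2) Hu Hv. apply (dlim_bound (mono a u v)); [|auto].
  intros M N. eapply Rle_trans; [apply dabs_mono_le; eassumption|apply H1].
Qed.

Lemma rep_nonneg r s B F : rep r s B F -> (0 <= B)%R.
Proof.
  intros (a & H1 & _). eapply Rle_trans; [apply dabs_nonneg|apply (H1 O O)].
Qed.

Lemma rep_ext r s B F G : rep r s B F ->
  (forall u v, (Cmod u <= r)%R -> (Cmod v <= s)%R -> F u v = G u v) -> rep r s B G.
Proof.
  intros (a & H1 & H2) E. exists a. split; [exact H1|].
  intros u v Hu Hv. rewrite <- E; auto.
Qed.

Lemma rep_le r s B r' s' B' F : rep r s B F ->
  (0 <= r' <= r)%R -> (0 <= s' <= s)%R -> (B <= B')%R -> rep r' s' B' F.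
Proof.
  intros (a & H1 & H2) Hr Hs HB. exists a. split.
  - intros M N. eapply Rle_trans; [|exact HB]. eapply Rle_trans; [|apply (H1 M N)].
    apply dabs_mono_le; rewrite Cmod_RtoC_pos; lra.
  - intros u v Hu Hv. apply H2; lra.
Qed.

Lemma rep_swap r s B F : rep r s B F -> rep s r B (fun u v => F v u).
Proof.
  intros (a & H1 & H2). exists (fun m n => a n m).
  assert (E : forall u v m n, mono a u v n m = mono (fun m n => a n m) v u m n)
    by (intros; unfold mono; ring).
  split.
  - intros M N. rewrite <- (dabs_ext _ _ M N (E r s)), dabs_swap. apply H1.
  - intros u v Hu Hv. eapply dlim_ext; [apply E|]. apply dlim_swap. auto.
Qed.

Lemma rep_scal r s B F c : rep r s B F -> rep r s (Cmod c * B) (fun u v => c * F u v).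
Proof.
  intros (a & H1 & H2). exists (fun m n => c * a m n).
  assert (E : forall u v m n, c * mono a u v m n = mono (fun m n => c * a m n) u v m n)
    by (intros; unfold mono; ring).
  split.
  - intros M N. rewrite <- (dabs_ext _ _ M N (E r s)).
    eapply Rle_trans.
    + apply (dabs_le (Cmod c) _ (mono a r s)); [apply Cmod_ge_0|].
      intros. rewrite Cmod_mult. lra.
    + apply Rmult_le_compat_l; [apply Cmod_ge_0|apply H1].
  - intros u v Hu Hv. eapply dlim_ext; [apply E|]. apply dlim_scal. auto.
Qed.

Lemma rep_plus r s B B' F G : rep r s B F -> rep r s B' G ->
  rep r s (B + B') (fun u v => F u v + G u v).
Proof.
  intros (a & H1 & H2) (b & H1' & H2'). exists (fun m n => a m n + b m n).
  assert (E : forall u v m n,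
    mono a u v m n + mono b u v m n = mono (fun m n => a m n + b m n) u v m n)
    by (intros; unfold mono; ring).
  split.
  - intros M N. rewrite <- (dabs_ext _ _ M N (E r s)).
    eapply Rle_trans; [|apply Rplus_le_compat; [apply (H1 M N)|apply (H1' M N)]].
    unfold dabs. rewrite <- rsum_plus. apply rsum_le. intros m _.
    rewrite <- rsum_plus. apply rsum_le. intros n _. apply Cmod_triangle.
  - intros u v Hu Hv. eapply dlim_ext; [apply E|]. apply dlim_plus; auto.
Qed.

Lemma rep_mult_u r s B F : (0 <= r)%R -> rep r s B F ->
  rep r s (r * B) (fun u v => u * F u v).
Proof.
  intros Hr (a & H1 & H2). exists (rshift a).
  assert (E : forall u v m n,
    rshift (fun m n => u * mono a u v m n) m n = mono (rshift a) u v m n)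
    by (intros u v [|m] n; unfold mono; simpl; ring).
  split.
  - intros M N. rewrite <- (dabs_ext _ _ M N (E r s)).
    eapply Rle_trans; [apply dabs_rshift_le|].
    eapply Rle_trans.
    + apply (dabs_le r _ (mono a r s)); [exact Hr|].
      intros. rewrite Cmod_mult, Cmod_RtoC_pos; lra.
    + apply Rmult_le_compat_l; [exact Hr|apply H1].
  - intros u v Hu Hv. eapply dlim_ext; [apply E|]. apply dlim_rshift, dlim_scal. auto.
Qed.

Lemma rep_mult_v r s B F : (0 <= s)%R -> rep r s B F ->
  rep r s (s * B) (fun u v => v * F u v).
Proof.
  intros Hs H. apply rep_swap in H.
  apply (rep_swap _ _ _ (fun u v => u * F v u)). now apply (rep_mult_u s r B (fun u v => F v u)).
Qed.

Lemma rep_mult_mono r s B F c m n : (0 <= r)%R -> (0 <= s)%R -> rep r s B F ->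
  rep r s (Cmod c * r ^ m * s ^ n * B) (fun u v => c * u ^ m * v ^ n * F u v).
Proof.
  intros Hr Hs H.
  assert (Hv : rep r s (s ^ n * B) (fun u v => v ^ n * F u v)).
  { induction n as [|n IH]; simpl.
    - eapply rep_ext; [eapply rep_le; [exact H| | |]; lra|intros; simpl; ring].
    - eapply rep_ext; [eapply rep_le; [apply rep_mult_v; [exact Hs|exact IH]| | |]; lra
        |intros; simpl; ring]. }
  assert (Hu : rep r s (r ^ m * (s ^ n * B)) (fun u v => u ^ m * (v ^ n * F u v))).
  { induction m as [|m IH]; simpl.
    - eapply rep_ext; [eapply rep_le; [exact Hv| | |]; lra|intros; simpl; ring].
    - eapply rep_ext; [eapply rep_le; [apply rep_mult_u; [exact Hr|exact IH]| | |]; lra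
        |intros; simpl; ring]. }
  eapply rep_ext; [eapply rep_le; [apply (rep_scal _ _ _ _ c Hu)| | |]; lra
        |intros; simpl; ring].
Qed.

Lemma rep_const r s c : (0 <= r)%R -> (0 <= s)%R -> rep r s (Cmod c) (fun _ _ => c).
Proof.
  intros Hr Hs. exists (fun m n => match m, n with O, O => c | _, _ => 0 end).
  set (a := fun m n => match m, n with O, O => c | _, _ => 0 end).
  assert (Hs1 : forall u v M N, dsum (mono a u v) M N = c).
  { intros u v M N. induction M as [|M IH].
    - unfold dsum. rewrite csum_O. induction N as [|N IH].
      + rewrite csum_O. unfold mono, a. simpl. cring.
      + rewrite csum_Sn, IH. unfold mono, a. cring.
    - rewrite dsum_SM, IH.
      rewrite (sum_n_ext _ (fun _ => RtoC 0)) by (intros; unfold mono, a; cring).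
      rewrite csum_0. cring. }
  split.
  - intros M N. induction M as [|M IH].
    + induction N as [|N IH].
      * unfold dabs. rewrite !rsum_O. unfold mono, a. simpl. rewrite !Cmult_1_r. lra.
      * rewrite dabs_SN, rsum_zero; [lra|].
        intros k. unfold mono, a. destruct k; now rewrite !Cmult_0_l, Cmod_0.
    + rewrite dabs_SM, rsum_zero; [lra|].
      intros k. unfold mono, a. now rewrite !Cmult_0_l, Cmod_0.
  - intros u v _ _ eps He. exists O. intros. rewrite Hs1.
    replace (c - c) with (RtoC 0) by ring. now rewrite Cmod_0.
Qed.
(** Multiplying by such phases turns a sum of moduli into a linear expression in the summands, which
    can be passed through a limit. *)
Lemma Cmod_phase (z : C) : exists t : C, (Cmod t <= 1)%R /\ t * z = Cmod z.
Proof.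
  destruct (Ceq_dec z 0) as [->|Hz].
  - exists 0. rewrite Cmod_0. split; [lra|ring].
  - assert (Hp : (0 < Cmod z)%R) by now apply Cmod_gt_0.
    exists (Cmod z / z). split.
    + rewrite Cmod_div, Cmod_RtoC_pos by (auto; lra). apply Req_le. field. lra.
    + field. exact Hz.
Qed.

Lemma RtoC_dabs f M N : RtoC (dabs f M N) = dsum (fun m n => RtoC (Cmod (f m n))) M N.
Proof.
  assert (E : forall (g : nat -> R) n, RtoC (sum_n g n) = sum_n (fun k => RtoC (g k)) n).
  { intros g n. induction n as [|n IH].
    - now rewrite rsum_O, csum_O.
    - now rewrite rsum_Sn, csum_Sn, RtoC_plus, IH. }
  unfold dabs, dsum. rewrite E. apply sum_n_ext. intros. apply E.
Qed.

(* Tannery's theorem, for a double series of elements of the algebra. *)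
Lemma rep_dsum r s B (Mb : nat -> nat -> R) (F : nat -> nat -> C -> C -> C) G :
  (0 < r)%R -> (0 < s)%R ->
  (forall k l, rep r s (Mb k l) (F k l)) ->
  (forall K L, (dabs (fun k l => RtoC (Mb k l)) K L <= B)%R) ->
  (forall u v, (Cmod u <= r)%R -> (Cmod v <= s)%R -> dlim (fun k l => F k l u v) (G u v)) ->
  rep r s B G.
Proof.
  intros Hr Hs HF HB HG.
  assert (HM : forall k l, Cmod (RtoC (Mb k l)) = Mb k l).
  { intros. apply Cmod_RtoC_pos. apply (rep_nonneg _ _ _ _ (HF k l)). }
  destruct (functional_choice (fun (kl : nat * nat) (a : nat -> nat -> C) =>
    (forall M N, (dabs (mono a r s) M N <= Mb (fst kl) (snd kl))%R) /\
    forall u v, (Cmod u <= r)%R -> (Cmod v <= s)%R ->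
      dlim (mono a u v) (F (fst kl) (snd kl) u v))) as [a0 Ha0].
  { intros [k l]. apply HF. }
  set (a := fun k l => a0 (k, l)).
  assert (Ha1 : forall k l M N, (dabs (mono (a k l) r s) M N <= Mb k l)%R)
    by (intros k l; apply (Ha0 (k, l))).
  assert (Ha2 : forall k l u v, (Cmod u <= r)%R -> (Cmod v <= s)%R ->
      dlim (mono (a k l) u v) (F k l u v)) by (intros k l; apply (Ha0 (k, l))).
  clearbody a. clear a0 Ha0.
  (* Coefficients of the sum: a single term is at most the norm, so |a k l m n| r^m s^n <= Mb k l,
     and the series over (k, l) converges absolutely. *)
  assert (Hb : forall mn : nat * nat, exists b, dlim (fun k l => a k l (fst mn) (snd mn)) b).
  { intros [m n]. simpl.
    assert (Hw : (0 < r ^ m * s ^ n)%R) by (apply Rmult_lt_0_compat; now apply pow_lt).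
    apply (dlim_ex _ (/ (r ^ m * s ^ n) * B)%R). intros K L.
    eapply Rle_trans; [apply (dabs_le (/ (r ^ m * s ^ n)) _ (fun k l => RtoC (Mb k l)))|].
    - left. now apply Rinv_0_lt_compat.
    - intros k l. rewrite HM.
      apply Rmult_le_reg_l with (r ^ m * s ^ n)%R; [exact Hw|].
      rewrite <- Rmult_assoc, Rinv_r, Rmult_1_l by lra.
      assert (T := term_le_dabs (mono (a k l) r s) m n m n ltac:(lia) ltac:(lia)).
      rewrite Cmod_mono_pos in T by lra. specialize (Ha1 k l m n). lra.
    - apply Rmult_le_compat_l; [left; now apply Rinv_0_lt_compat|apply HB]. }
  apply functional_choice in Hb. destruct Hb as [b0 Hb0].
  set (b := fun m n => b0 (m, n)).
  assert (Hb : forall m n, dlim (fun k l => a k l m n) (b m n))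
    by (intros m n; apply (Hb0 (m, n))).
  clearbody b. clear b0 Hb0.
  assert (Hmono : forall u v m n, dlim (fun k l => mono (a k l) u v m n) (mono b u v m n)).
  { intros u v m n. unfold mono.
    replace (b m n * u ^ m * v ^ n) with (u ^ m * v ^ n * b m n) by ring.
    eapply dlim_ext; [|apply dlim_scal, Hb]. intros. cbv beta. ring. }
  exists b. split.
  - intros M N.
    (* The phases [t] depend on the limit coefficients [b] only. With them the norm of the limit is
       itself a limit of sums bounded by the sum of the [Mb k l]. *)
    destruct (functional_choice (fun (mn : nat * nat) (t : C) =>
      (Cmod t <= 1)%R /\ t * mono b r s (fst mn) (snd mn) = Cmod (mono b r s (fst mn) (snd mn))))
      as [t Ht]; [intros; apply Cmod_phase|].
    rewrite <- (Cmod_RtoC_pos (dabs (mono b r s) M N)) by apply dabs_nonneg.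
    rewrite RtoC_dabs.
    apply (dlim_bound (fun k l => dsum (fun m n => t (m, n) * mono (a k l) r s m n) M N)).
    + intros K L. eapply Rle_trans; [|apply (HB K L)].
      apply dabs_le1. intros k l. rewrite HM.
      eapply Rle_trans; [apply dsum_le_dabs|]. eapply Rle_trans; [|apply (Ha1 k l M N)].
      apply dabs_le1. intros m n. rewrite Cmod_mult.
      destruct (Ht (m, n)) as [Ht1 _].
      assert (T := Cmod_ge_0 (mono (a k l) r s m n)). nra.
    + apply dlim_dsum. intros m n. destruct (Ht (m, n)) as [_ Ht2]. simpl in Ht2.
      rewrite <- Ht2. apply dlim_scal, Hmono.
  - intros u v Hu Hv eps He.
    (* [K0] makes the sum of the [Mb] outside the square smaller than eps / 4. This one tail bound
       controls both the functions [F k l] and their truncated expansions; the finite sum in between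
       converges term by term. *)
    destruct (dabs_sup _ _ HB) as (B' & _ & HB' & HS).
    destruct (HS (eps / 4)%R ltac:(lra)) as [K0 HK0].
    assert (HFb : forall k l, (Cmod (F k l u v) <= Cmod (RtoC (Mb k l)))%R).
    { intros k l. rewrite HM. apply (rep_bound r s); auto. }
    assert (Htail := dlim_tail_dom _ _ _ _ K0 K0 HFb HB' (HG u v Hu Hv)).
    assert (Hfin : dlim (fun m n => dsum (fun k l => mono (a k l) u v m n) K0 K0)
      (dsum (fun k l => F k l u v) K0 K0)).
    { apply (dlim_dsum (fun m n k l => mono (a k l) u v m n)). intros. now apply Ha2. }
    destruct (Hfin (eps / 4)%R ltac:(lra)) as [N0 HN0].
    exists N0. intros M N HM0 HN. specialize (HN0 M N HM0 HN).
    assert (E : dsum (fun m n => dsum (fun k l => mono (a k l) u v m n) K0 K0) M N =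
      dsum (fun k l => dsum (mono (a k l) u v) M N) K0 K0).
    { unfold dsum at 2. rewrite dsum_sum. apply sum_n_ext. intros k.
      apply (dsum_sum (fun l m n => mono (a k l) u v m n)). }
    rewrite E in HN0.
    assert (Htail2 : (Cmod (dsum (mono b u v) M N -
      dsum (fun k l => dsum (mono (a k l) u v) M N) K0 K0) <=
      B' - dabs (fun k l => RtoC (Mb k l)) K0 K0)%R).
    { apply (dlim_tail_dom (fun k l => dsum (mono (a k l) u v) M N)); [|exact HB'|].
      - intros k l. rewrite HM. eapply Rle_trans; [apply dsum_le_dabs|].
        eapply Rle_trans; [apply (dabs_mono_le _ _ _ r s); assumption|apply Ha1].
      - apply dlim_dsum. intros. apply Hmono. }
    set (x := dsum (mono b u v) M N) in *.
    set (y := dsum (fun k l => dsum (mono (a k l) u v) M N) K0 K0) in *.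
    set (z := dsum (fun k l => F k l u v) K0 K0) in *.
    assert (T1 := Cmod_sub_le x y (G u v)). assert (T2 := Cmod_sub_le y z (G u v)).
    rewrite (Cmod_sub_sym z (G u v)) in T2. lra.
Qed.

(** Only [F] is expanded: F G is the sum of the functions a_kl u^k v^l G, whose norms are
    summable. *)
Lemma rep_mult r s B B' F G : (0 < r)%R -> (0 < s)%R -> rep r s B F -> rep r s B' G ->
  rep r s (B * B') (fun u v => F u v * G u v).
Proof.
  intros Hr Hs (a & H1 & H2) HG.
  assert (HB' := rep_nonneg _ _ _ _ HG).
  apply (rep_dsum r s _ (fun k l => (Cmod (a k l) * r ^ k * s ^ l * B')%R)
    (fun k l u v => a k l * u ^ k * v ^ l * G u v)); auto.
  - intros. apply rep_mult_mono; auto; lra.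
  - intros K L. rewrite Rmult_comm. eapply Rle_trans.
    + apply (dabs_le B' _ (mono a r s)); [exact HB'|]. intros k l.
      rewrite <- (Cmod_mono_pos a r s k l) by lra.
      rewrite Cmod_RtoC_pos; [lra|]. apply Rmult_le_pos; [apply Cmod_ge_0|exact HB'].
    + now apply Rmult_le_compat_l.
  - intros u v Hu Hv. rewrite Cmult_comm. eapply dlim_ext; [|apply dlim_scal, H2; assumption].
    intros. unfold mono. ring.
Qed.

Lemma rep_pow r s B F n : (0 < r)%R -> (0 < s)%R -> rep r s B F ->
  rep r s (B ^ n) (fun u v => F u v ^ n).
Proof.
  intros Hr Hs H. induction n as [|n IH]; simpl.
  - apply (rep_le r s (Cmod 1)); [apply rep_const| | |rewrite Cmod_1]; lra.
  - now apply rep_mult.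
Qed.

(** The terms a_kl U^k V^l have norm at most |a_kl| BU^k BV^l, hence at most |a_kl| p^k q^l, so
    their sum is controlled by the norm bound of [F]. *)
Lemma rep_comp p q r s B BU BV F U V : (0 < r)%R -> (0 < s)%R ->
  rep p q B F -> rep r s BU U -> rep r s BV V -> (BU <= p)%R -> (BV <= q)%R ->
  rep r s B (fun u v => F (U u v) (V u v)).
Proof.
  intros Hr Hs (a & H1 & H2) HU HV Hp Hq.
  assert (HU0 := rep_nonneg _ _ _ _ HU). assert (HV0 := rep_nonneg _ _ _ _ HV).
  apply (rep_dsum r s _ (fun k l => (Cmod (a k l) * BU ^ k * BV ^ l)%R)
    (fun k l u v => a k l * U u v ^ k * V u v ^ l)); auto.
  - intros k l. apply rep_mult; auto; [|now apply rep_pow].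
    apply rep_mult; auto; [|now apply rep_pow]. apply rep_const; lra.
  - intros K L. eapply Rle_trans; [|apply (H1 K L)].
    apply dabs_le1. intros k l. rewrite <- (Cmod_mono_pos a BU BV k l) by auto.
    rewrite (Cmod_RtoC_pos _ (Cmod_ge_0 _)). apply Cmod_mono_le; rewrite !Cmod_RtoC_pos; lra.
  - intros u v Hu Hv. apply H2; eapply Rle_trans; try (eapply rep_bound; eassumption); auto.
Qed.

Lemma rep_fst r s : (0 <= r)%R -> (0 <= s)%R -> rep r s r (fun u _ => u).
Proof.
  intros Hr Hs. eapply rep_ext; [eapply rep_le; [apply rep_mult_u; [exact Hr|]|..]|].
  - now apply (rep_const r s 1).
  - lra.
  - lra.
  - rewrite Cmod_1. lra.
  - intros. simpl. ring.
Qed.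

Lemma rep_snd r s : (0 <= r)%R -> (0 <= s)%R -> rep r s s (fun _ v => v).
Proof. intros Hr Hs. apply (rep_swap s r s (fun u _ => u)). now apply rep_fst. Qed.

(** Row 0 of the coefficients is dropped and the others move down, which costs the factor 1 / r in
    the norm. As [F1] is defined at u = 0 too, it serves later both as difference quotient and as
    derivative. *)
Lemma rep_divide_u r s B F : (0 < r)%R -> (0 <= s)%R -> rep r s B F ->
  exists F1, rep r s (B / r) F1 /\
    forall u v, (Cmod u <= r)%R -> (Cmod v <= s)%R -> F u v = F 0 v + u * F1 u v.
Proof.
  intros Hr Hs (a & H1 & H2).
  set (a' := fun m n => a (S m) n).
  assert (Hsh : forall u v m n, (fun m n => u * mono a' u v m n) m n = mono a u v (S m) n)
    by (intros; unfold mono, a'; simpl; ring).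
  assert (Hb : forall M N, (dabs (mono a' r s) M N <= B / r)%R).
  { intros M N. apply Rmult_le_reg_l with r; [exact Hr|].
    replace (r * (B / r))%R with B by (field; lra).
    eapply Rle_trans; [|apply (H1 (S M) N)].
    apply Rle_trans with (dabs (fun m n => r * mono a' r s m n) M N).
    - apply Rmult_le_reg_l with (/ r)%R; [now apply Rinv_0_lt_compat|].
      rewrite <- Rmult_assoc, Rinv_l, Rmult_1_l by lra.
      apply dabs_le; [left; now apply Rinv_0_lt_compat|].
      intros. rewrite (Cmod_mult r), (Cmod_RtoC_pos r) by lra. apply Req_le. field. lra.
    - rewrite (dabs_ext _ _ M N (Hsh r s)). unfold dabs. rewrite rsum_shift.
      rewrite <- (Rplus_0_l (sum_n _ M)) at 1. apply Rplus_le_compat_r.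
      apply rsum_nonneg. intros. apply Cmod_ge_0. }
  (* The choice ranges over all pairs, hence the guards: outside the closed bidisc 0 is taken as a
     default. *)
  assert (Hc : forall p : C * C, exists l, (Cmod (fst p) <= r)%R -> (Cmod (snd p) <= s)%R ->
    dlim (mono a' (fst p) (snd p)) l).
  { intros [u v]. simpl.
    destruct (Rle_dec (Cmod u) r) as [Hu|Hu]; [|exists 0; now intros].
    destruct (Rle_dec (Cmod v) s) as [Hv|Hv]; [|exists 0; now intros].
    destruct (dlim_ex (mono a' u v) (B / r)) as [l Hl]; [|now exists l].
    intros M N. eapply Rle_trans; [apply dabs_mono_le; eassumption|apply Hb]. }
  apply functional_choice in Hc. destruct Hc as [F1 HF1].
  exists (fun u v => F1 (u, v)). split.
  - exists a'. split; [exact Hb|]. intros u v. apply (HF1 (u, v)).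
  - intros u v Hu Hv. apply (dlim_unique (mono a u v)); [now apply H2|].
    eapply dlim_ext; [|apply dlim_plus;
      [apply (H2 0 v); [rewrite Cmod_0; lra|exact Hv]
      |apply dlim_rshift, (dlim_scal u), (HF1 (u, v)); assumption]].
    intros [|m] n; unfold mono, a'; simpl; ring.
Qed.

Lemma rep_analytic2 (G : C -> C -> C) u0 v0 r s B : (0 < r)%R -> (0 < s)%R ->
  rep r s B (fun u v => G (u0 + u) (v0 + v)) -> analytic2_at G u0 v0.
Proof.
  intros Hr Hs H.
  assert (Hm : (0 < Rmin r s)%R) by now apply Rmin_glb_lt.
  destruct (rep_le _ _ _ (Rmin r s) (Rmin r s) B _ H) as (a & H1 & H2).
  { split; [lra|apply Rmin_l]. } { split; [lra|apply Rmin_r]. } { lra. }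
  exists a, (mkposreal _ Hm). split.
  - exists B. intros N. eapply Rle_trans; [|apply (H1 N N)]. apply Req_le.
    apply sum_n_ext. intros m. apply sum_n_ext. intros n. simpl.
    rewrite Cmod_mono_pos, pow_add by lra. ring.
  - simpl. intros u v Hu Hv.
    specialize (H2 (u - u0) (v - v0) (Rlt_le _ _ Hu) (Rlt_le _ _ Hv)). cbv beta in H2.
    replace (u0 + (u - u0)) with u in H2 by ring.
    replace (v0 + (v - v0)) with v in H2 by ring.
    apply filterlim_locally. intros eps.
    destruct (H2 eps (cond_pos eps)) as [N0 HN0]. exists N0. intros N HN.
    apply C_NormedModule_mixin_compat1. apply (HN0 N N HN HN).
Qed.

(** * Series in one index, the geometric series, continuity *)

Definition slim (f : nat -> C) (l : C) : Prop :=
  forall eps : R, (0 < eps)%R -> exists N0 : nat, forall N : nat,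
    (N0 <= N)%nat -> (Cmod (sum_n f N - l) < eps)%R.

(** A simple series is stored in column 0 of a double one, so that the theorems above apply
    unchanged. [T] varies because terms, norms and functions are all stored this way. *)
Definition column {T} (z : T) (f : nat -> T) (k l : nat) : T :=
  match l with O => f k | _ => z end.

Lemma dsum_column f M N : dsum (column (RtoC 0) f) M N = sum_n f M.
Proof.
  apply sum_n_ext. intros k. induction N as [|N IH].
  - apply csum_O.
  - rewrite csum_Sn, IH. apply Cplus_0_r.
Qed.

Lemma dabs_column f M N : dabs (column (RtoC 0) f) M N = sum_n (fun k => Cmod (f k)) M.
Proof.
  apply sum_n_ext. intros k. induction N as [|N IH].
  - apply rsum_O.
  - rewrite rsum_Sn, IH. simpl. rewrite Cmod_0. lra.
Qed.

Lemma slim_dlim f l : slim f l <-> dlim (column (RtoC 0) f) l.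
Proof.
  split; intros H eps He; destruct (H eps He) as [N0 HN]; exists N0.
  - intros M N HM _. rewrite dsum_column. auto.
  - intros N HN'. rewrite <- (dsum_column f N N). auto.
Qed.

Lemma slim_ex f B : (forall N, (sum_n (fun k => Cmod (f k)) N <= B)%R) -> exists l, slim f l.
Proof.
  intros H. destruct (dlim_ex (column (RtoC 0) f) B) as [l Hl].
  - intros. rewrite dabs_column. apply H.
  - exists l. now apply slim_dlim.
Qed.

Lemma slim_CSeries f l : slim f l -> CSeries f = l.
Proof.
  intros H. destruct l as [x y]. unfold CSeries. f_equal; apply is_series_unique.
  - change (is_lim_seq (sum_n (fun n => Re (f n))) x).
    apply is_lim_seq_spec. intros eps. destruct (H eps (cond_pos eps)) as [N0 HN].
    exists N0. intros n Hn. eapply Rle_lt_trans; [|apply (HN n Hn)].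
    eapply Rle_trans; [|apply re_le_Cmod]. apply Req_le. f_equal.
    change (Re (sum_n f n - (x, y))) with (Re (sum_n f n) - x)%R. f_equal.
    clear. induction n as [|n IH].
    + now rewrite rsum_O, csum_O.
    + rewrite rsum_Sn, csum_Sn, IH. reflexivity.
  - change (is_lim_seq (sum_n (fun n => Im (f n))) y).
    apply is_lim_seq_spec. intros eps. destruct (H eps (cond_pos eps)) as [N0 HN].
    exists N0. intros n Hn. eapply Rle_lt_trans; [|apply (HN n Hn)].
    eapply Rle_trans; [|apply Rmax_Cmod]. eapply Rle_trans; [|apply Rmax_r].
    apply Req_le. f_equal.
    change (snd (sum_n f n - (x, y))) with (Im (sum_n f n) - y)%R. f_equal.
    clear. induction n as [|n IH].
    + now rewrite rsum_O, csum_O.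
    + rewrite rsum_Sn, csum_Sn, IH. reflexivity.
Qed.

Lemma rep_series r s B (Mb : nat -> R) (F : nat -> C -> C -> C) G :
  (0 < r)%R -> (0 < s)%R -> (forall k, rep r s (Mb k) (F k)) ->
  (forall N, (sum_n Mb N <= B)%R) ->
  (forall u v, (Cmod u <= r)%R -> (Cmod v <= s)%R -> slim (fun k => F k u v) (G u v)) ->
  rep r s B G.
Proof.
  intros Hr Hs HF HB HG.
  apply (rep_dsum r s B (column 0%R Mb) (column (fun _ _ => RtoC 0) F)); auto.
  - intros k [|l]; [apply HF|]. simpl.
    apply (rep_le r s (Cmod 0)); [apply rep_const| | |rewrite Cmod_0]; lra.
  - intros K L.
    rewrite (dabs_ext _ (column (RtoC 0) (fun k => RtoC (Mb k)))) by (intros m [|n]; reflexivity).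
    rewrite dabs_column.
    rewrite (sum_n_ext _ Mb); [apply HB|]. intros k. apply Cmod_RtoC_pos.
    apply (rep_nonneg _ _ _ _ (HF k)).
  - intros u v Hu Hv. eapply dlim_ext; [|apply slim_dlim, HG; assumption].
    intros k [|l]; reflexivity.
Qed.

Lemma geom_sum q N : (q <> 1)%R -> sum_n (fun k => (q ^ k)%R) N = ((1 - q ^ S N) / (1 - q))%R.
Proof.
  intros Hq. induction N as [|N IH].
  - rewrite rsum_O. simpl. field. lra.
  - rewrite rsum_Sn, IH. simpl. field. lra.
Qed.

(** At radius 1/2 the powers x^k have norms 2^-k, which sum to 2. *)
Lemma rep_geometric s : (0 < s)%R -> rep (1 / 2) s 2 (fun x _ => / (1 - x)).
Proof.
  intros Hs.
  apply (rep_series _ _ _ (fun k => ((1 / 2) ^ k)%R) (fun k x _ => x ^ k)); [lra|exact Hs|..].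
  - intros k. apply (rep_pow (1 / 2) s (1 / 2) (fun x _ => x)); try lra. apply rep_fst; lra.
  - intros N. rewrite geom_sum by lra. assert (0 < (1 / 2) ^ S N)%R by (apply pow_lt; lra). lra.
  - intros x _ Hx _ eps He.
    assert (Hx1 : 1 - x <> 0).
    { intros E. assert (x = 1) as -> by (replace x with (1 - (1 - x)) by ring; rewrite E; ring).
      rewrite Cmod_1 in Hx. lra. }
    assert (Hinv : (1 / 2 <= Cmod (1 - x))%R).
    { assert (T := Cmod_triangle (1 - x) x). replace (1 - x + x) with (RtoC 1) in T by ring.
      rewrite Cmod_1 in T. lra. }
    destruct (pow_lt_1_zero (1 / 2)) with (y := (eps / 2)%R) as [N0 HN0];
      [rewrite Rabs_pos_eq; lra|lra|].
    exists N0. intros N HN. specialize (HN0 (S N) ltac:(lia)).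
    assert (E : sum_n (fun k => x ^ k) N - / (1 - x) = - (x ^ S N / (1 - x))).
    { induction N as [|N IH] in |- *.
      - rewrite csum_O. simpl. field. exact Hx1.
      - rewrite csum_Sn.
        replace (sum_n (fun k => x ^ k) N + x ^ S N - / (1 - x))
          with (sum_n (fun k => x ^ k) N - / (1 - x) + x ^ S N) by cring.
        rewrite IH. simpl. field. exact Hx1. }
    rewrite E, Cmod_opp, Cmod_div, Cmod_pow by exact Hx1.
    rewrite Rabs_pos_eq in HN0 by (apply pow_le; lra).
    assert (P : (Cmod x ^ S N <= (1 / 2) ^ S N)%R)
      by (apply pow_incr; split; [apply Cmod_ge_0|exact Hx]).
    apply Rmult_lt_reg_r with (Cmod (1 - x)); [lra|].
    unfold Rdiv. rewrite Rmult_assoc, Rinv_l by lra. nra.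
Qed.

Lemma rep_divide_v r s B F : (0 <= r)%R -> (0 < s)%R -> rep r s B F ->
  exists F1, rep r s (B / s) F1 /\
    forall u v, (Cmod u <= r)%R -> (Cmod v <= s)%R -> F u v = F u 0 + v * F1 u v.
Proof.
  intros Hr Hs H. apply rep_swap in H.
  destruct (rep_divide_u _ _ _ _ Hs Hr H) as (F1 & H1 & H2).
  exists (fun u v => F1 v u). split; [now apply rep_swap in H1|auto].
Qed.

Lemma rep_translate r s B F u0 v0 r' s' : (0 < r')%R -> (0 < s')%R -> rep r s B F ->
  (Cmod u0 + r' <= r)%R -> (Cmod v0 + s' <= s)%R ->
  rep r' s' B (fun u v => F (u0 + u) (v0 + v)).
Proof.
  intros Hr Hs H Hu Hv.
  apply (rep_comp r s r' s' B (Cmod u0 + r') (Cmod v0 + s') F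
    (fun u _ => u0 + u) (fun _ v => v0 + v)); auto.
  - apply (rep_plus _ _ _ _ (fun _ _ => u0) (fun u _ => u)); [apply rep_const|apply rep_fst]; lra.
  - apply (rep_plus _ _ _ _ (fun _ _ => v0) (fun _ v => v)); [apply rep_const|apply rep_snd]; lra.
Qed.

(** F - F(0, 0) = u F1(u, v) + v F2(0, v), where the quotients have norms B / r and B / s; on the
    radii t r and t s each summand has norm at most t B. *)
Lemma rep_sub_const r s B F t : (0 < r)%R -> (0 < s)%R -> rep r s B F -> (0 < t <= 1)%R ->
  rep (t * r) (t * s) (2 * t * B) (fun u v => F u v - F 0 0).
Proof.
  intros Hr Hs H Ht.
  assert (HB := rep_nonneg _ _ _ _ H).
  assert (Htr : (0 < t * r <= r)%R) by nra. assert (Hts : (0 < t * s <= s)%R) by nra.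
  destruct (rep_divide_u r s B F Hr (Rlt_le _ _ Hs) H) as (F1 & H1 & E1).
  destruct (rep_divide_v r s B F (Rlt_le _ _ Hr) Hs H) as (F2 & H2 & E2).
  assert (G1 : rep (t * r) (t * s) (t * B) (fun u v => u * F1 u v)).
  { apply (rep_le (t * r) (t * s) (t * r * (B / r))).
    - apply rep_mult_u; [lra|]. apply (rep_le r s (B / r)); [exact H1|lra..].
    - lra.
    - lra.
    - apply Req_le. field. lra. }
  assert (G2 : rep (t * r) (t * s) (t * B) (fun _ v => v * F2 0 v)).
  { apply (rep_comp r (t * s) (t * r) (t * s) _ (Cmod 0) (t * s)
      (fun u v => v * F2 u v) (fun _ _ => 0) (fun _ v => v)); try lra.
    - apply (rep_le r (t * s) (t * s * (B / s))).
      + apply rep_mult_v; [lra|]. apply (rep_le r s (B / s)); [exact H2|lra..].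
      + lra.
      + lra.
      + apply Req_le. field. lra.
    - apply rep_const; lra.
    - apply rep_snd; lra.
    - rewrite Cmod_0. lra. }
  apply (rep_ext _ _ _ (fun u v => u * F1 u v + v * F2 0 v)).
  { apply (rep_le (t * r) (t * s) (t * B + t * B)); [now apply rep_plus|lra..]. }
  intros u v Hu Hv. simpl. rewrite (E1 u v), (E2 0 v) by (rewrite ?Cmod_0; lra). ring.
Qed.

Lemma rep_cont r s B F eps : (0 < r)%R -> (0 < s)%R -> rep r s B F -> (0 < eps)%R ->
  exists d, (0 < d)%R /\ forall u v, (Cmod u < d)%R -> (Cmod v < d)%R ->
    (Cmod (F u v - F 0 0) < eps)%R.
Proof.
  intros Hr Hs H He. assert (HB := rep_nonneg _ _ _ _ H).
  set (t := Rmin 1 (eps / (4 * B + 1))).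
  assert (Hq : (0 < eps / (4 * B + 1))%R) by (apply Rdiv_lt_0_compat; lra).
  assert (Ht : (0 < t <= 1)%R) by (split; [apply Rmin_glb_lt; lra|apply Rmin_l]).
  assert (Ht2 : (t <= eps / (4 * B + 1))%R) by apply Rmin_r.
  assert (Hb : (t * (4 * B + 1) <= eps)%R).
  { apply Rmult_le_compat_r with (r := (4 * B + 1)%R) in Ht2; [|lra].
    replace (eps / (4 * B + 1) * (4 * B + 1))%R with eps in Ht2 by (field; lra). exact Ht2. }
  assert (R' := rep_sub_const r s B F t Hr Hs H Ht).
  exists (Rmin (t * r) (t * s)). split; [apply Rmin_glb_lt; nra|].
  intros u v Hu Hv.
  assert (Hu' := Rmin_l (t * r) (t * s)). assert (Hv' := Rmin_r (t * r) (t * s)).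
  assert (T := rep_bound _ _ _ _ u v R' ltac:(lra) ltac:(lra)). simpl in T. nra.
Qed.

Lemma pow_n_Cpow (x : C) n : pow_n (K := C_Ring) x n = x ^ n.
Proof. induction n as [|n IH]; simpl; [reflexivity|]. rewrite IH. reflexivity. Qed.

Lemma mono_0_l a v m n : mono a 0 v (S m) n = 0.
Proof. unfold mono. simpl. ring. Qed.

(** At first variable 0 only row 0 of the coefficients remains, and it is the one-variable
    expansion. *)
Lemma rep_analytic1 (G : C -> C) z0 r s B : (0 < r)%R -> (0 < s)%R ->
  rep r s B (fun _ v => G (z0 + v)) -> analytic_at G z0.
Proof.
  intros Hr Hs (a & _ & H2). exists (a O), (mkposreal _ Hs). simpl. intros z Hz.
  specialize (H2 0 (z - z0)). cbv beta in H2.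
  replace (z0 + (z - z0)) with z in H2 by ring. rewrite Cmod_0 in H2.
  specialize (H2 (Rlt_le _ _ Hr) (Rlt_le _ _ Hz)).
  apply filterlim_locally. intros eps.
  destruct (H2 eps (cond_pos eps)) as [N0 HN0]. exists N0. intros N HN.
  apply C_NormedModule_mixin_compat1. specialize (HN0 N N HN HN).
  eapply Rle_lt_trans; [|exact HN0]. apply Req_le. f_equal.
  change (sum_n (fun k => pow_n (K := C_Ring) (z - z0) k * a O k) N - G z
    = dsum (mono a 0 (z - z0)) N N - G z). f_equal.
  transitivity (sum_n (mono a 0 (z - z0) O) N).
  - apply sum_n_ext. intros k. rewrite pow_n_Cpow. unfold mono. simpl.
    change ((z - z0) ^ k * a O k = a O k * 1 * (z - z0) ^ k). ring.
  - generalize N at 2. intros M. induction M as [|M IH].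
    + symmetry. apply csum_O.
    + rewrite dsum_SM, <- IH.
      rewrite (sum_n_ext (mono a 0 (z - z0) (S M)) (fun _ => RtoC 0))
        by (intros; apply mono_0_l).
      rewrite csum_0. symmetry. apply Cplus_0_r.
Qed.

(** * Entire functions *)

(** Asking for all radii makes substitution unconditional: the norms of the inner functions decide
    which radius to use for the outer one. *)
Definition entire2 (F : C -> C -> C) : Prop :=
  forall r, (0 < r)%R -> exists B, rep r r B F.

Lemma entire2_const c : entire2 (fun _ _ => c).
Proof. intros r Hr. exists (Cmod c). apply rep_const; lra. Qed.

Lemma entire2_fst : entire2 (fun u _ => u).
Proof. intros r Hr. exists r. apply rep_fst; lra. Qed.

Lemma entire2_snd : entire2 (fun _ v => v).
Proof. intros r Hr. exists r. apply rep_snd; lra. Qed.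

Lemma entire2_plus F G : entire2 F -> entire2 G -> entire2 (fun u v => F u v + G u v).
Proof.
  intros HF HG r Hr. destruct (HF r Hr) as [B HB], (HG r Hr) as [B' HB'].
  exists (B + B')%R. now apply rep_plus.
Qed.

Lemma entire2_mult F G : entire2 F -> entire2 G -> entire2 (fun u v => F u v * G u v).
Proof.
  intros HF HG r Hr. destruct (HF r Hr) as [B HB], (HG r Hr) as [B' HB'].
  exists (B * B')%R. now apply rep_mult.
Qed.

Lemma entire2_pow F n : entire2 F -> entire2 (fun u v => F u v ^ n).
Proof.
  intros HF r Hr. destruct (HF r Hr) as [B HB]. exists (B ^ n)%R. now apply rep_pow.
Qed.

Lemma entire2_ext F G : (forall u v, F u v = G u v) -> entire2 F -> entire2 G.
Proof.
  intros E HF r Hr. destruct (HF r Hr) as [B HB]. exists B.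
  eapply rep_ext; [exact HB|intros; apply E].
Qed.

Lemma entire2_comp F U V : entire2 F -> entire2 U -> entire2 V ->
  entire2 (fun u v => F (U u v) (V u v)).
Proof.
  intros HF HU HV r Hr. destruct (HU r Hr) as [B HB], (HV r Hr) as [B' HB'].
  assert (H0 := rep_nonneg _ _ _ _ HB).
  destruct (HF (Rmax B B' + 1)%R) as [B'' HB''].
  { assert (T := Rmax_l B B'). lra. }
  exists B''. assert (T := Rmax_l B B'). assert (T' := Rmax_r B B').
  eapply rep_comp; try eassumption; lra.
Qed.

Lemma entire2_analytic F u0 v0 : entire2 F -> analytic2_at F u0 v0.
Proof.
  intros HF. assert (H0 := Cmod_ge_0 u0). assert (H1 := Cmod_ge_0 v0).
  destruct (HF (Cmod u0 + Cmod v0 + 1)%R ltac:(lra)) as [B HB].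
  apply (rep_analytic2 _ _ _ 1 1 B); [lra|lra|].
  eapply rep_translate; [| |exact HB| |]; lra.
Qed.

Lemma is_derive_quadratic (h : C -> C) (x d : C) (del Q : R) : (0 < del)%R ->
  (forall w, (Cmod w <= del)%R -> (Cmod (h (x + w)%C - h x - w * d) <= Q * Cmod w ^ 2)%R) ->
  is_derive (K := C_AbsRing) (V := C_NormedModule) h x d.
Proof.
  intros Hd H. split; [apply is_linear_scal_l|].
  intros y Hy. assert (E : y = x) by (symmetry; now apply is_filter_lim_locally_unique).
  subst y. intros eps.
  assert (HQ : (0 < Rabs Q + 1)%R) by (assert (T := Rabs_pos Q); lra).
  assert (Hp : (0 < Rmin del (eps / (Rabs Q + 1)))%R).
  { apply Rmin_glb_lt; [exact Hd|]. apply Rdiv_lt_0_compat; [apply cond_pos|exact HQ]. }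
  exists (mkposreal _ Hp). clear Hy. intros y Hy. simpl in Hy.
  change (Cmod (y - x) < Rmin del (eps / (Rabs Q + 1)))%R in Hy.
  change (Cmod (h y - h x - (y - x) * d) <= eps * Cmod (y - x))%R.
  assert (T1 := Rmin_l del (eps / (Rabs Q + 1))). assert (T2 := Rmin_r del (eps / (Rabs Q + 1))).
  specialize (H (y - x) ltac:(lra)). assert (Exy : forall p q : C, p + (q - p) = q) by (intros; ring). rewrite Exy in H.
  eapply Rle_trans; [exact H|]. assert (T3 := Cmod_ge_0 (y - x)). assert (T4 := Rle_abs Q).
  simpl. rewrite Rmult_1_r, <- Rmult_assoc. apply Rmult_le_compat_r; [exact T3|].
  assert (E : (pos eps = (Rabs Q + 1) * (eps / (Rabs Q + 1)))%R) by (field; lra).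
  rewrite E. nra.
Qed.

(** Division of h(x + w) by w gives h(x) + w F1(w, x), and F1(0, x) is at once the derivative and an
    element of the algebra. [F1] depends on the radius, but uniqueness of the derivative identifies
    it with [C_derive] on each bidisc. *)
Lemma entire_derive (h : C -> C) : entire2 (fun x _ => h x) ->
  entire2 (fun x _ => C_derive h x) /\
  forall x, is_derive (K := C_AbsRing) (V := C_NormedModule) h x (C_derive h x).
Proof.
  intros H.
  assert (HG : entire2 (fun w x => h (x + w))).
  { apply (entire2_comp (fun x _ => h x) (fun w x => x + w) (fun _ _ => 0)); auto.
    - apply entire2_plus; [apply entire2_snd|apply entire2_fst].
    - apply entire2_const. }
  assert (Key : forall r, (0 < r)%R -> exists F1 B, rep r r B F1 /\ forall x, (Cmod x <= r)%R ->
    is_derive (K := C_AbsRing) (V := C_NormedModule) h x (F1 0 x)).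
  { intros r Hr. destruct (HG r Hr) as [B HB].
    destruct (rep_divide_u _ _ _ _ Hr (Rlt_le _ _ Hr) HB) as (F1 & HF1 & E1).
    (* A second division by w provides the quadratic remainder w^2 F2. *)
    destruct (rep_divide_u _ _ _ _ Hr (Rlt_le _ _ Hr) HF1) as (F2 & HF2 & E2).
    exists F1, (B / r)%R. split; [exact HF1|]. intros x Hx.
    apply (is_derive_quadratic _ _ _ r (B / r / r)%R Hr). intros w Hw.
    rewrite (E1 w x Hw Hx), (E2 w x Hw Hx), Cplus_0_r.
    replace (h x + w * (F1 0 x + w * F2 w x) - h x - w * F1 0 x) with (w ^ 2 * F2 w x) by ring.
    rewrite Cmod_mult, Cmod_pow, Rmult_comm. apply Rmult_le_compat_r.
    - apply pow_le, Cmod_ge_0.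
    - eapply rep_bound; eassumption. }
  split.
  - intros r Hr. destruct (Key r Hr) as (F1 & B & HF1 & HD). exists B.
    apply (rep_ext r r B (fun x _ => F1 0 x)).
    + apply (rep_comp r r r r B (Cmod 0) r F1 (fun _ _ => 0) (fun x _ => x)); try lra.
      * exact HF1.
      * apply rep_const; lra.
      * apply rep_fst; lra.
      * rewrite Cmod_0. lra.
    + intros x _ Hx _. symmetry. apply is_C_derive_unique. now apply HD.
  - intros x. destruct (Key (Cmod x + 1)%R) as (F1 & B & _ & HD).
    { assert (T := Cmod_ge_0 x). lra. }
    assert (D := HD x ltac:(lra)). rewrite (is_C_derive_unique _ _ _ D). exact D.
Qed.
(** * Linear factorization *)

Lemma slim_telescope (f : nat -> C) k : sum_n (fun j => f (S j) - f j) k = f (S k) - f O.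
Proof.
  induction k as [|k IH]; [apply csum_O|]. rewrite csum_Sn, IH. cring.
Qed.

(* The zero [g] is the limit of the iteration g <- - v K(g, v), where
   F(u, v) = u + v K(u, v); the iteration contracts the l^1 norm by 1/2. *)
Lemma implicit_function r s B F : (0 < r)%R -> (0 < s)%R -> rep r s B F ->
  (forall u, (Cmod u <= r)%R -> F u 0 = u) ->
  exists q g, (0 < q <= s)%R /\ rep r q (r / 4) (fun _ v => g v) /\
    forall v, (Cmod v <= q)%R -> F (g v) v = 0.
Proof.
  intros Hr Hs HF HF0.
  destruct (rep_divide_v r s B F (Rlt_le _ _ Hr) Hs HF) as (K & HK & EK).
  set (b := (B / s)%R) in *. assert (Hb := rep_nonneg _ _ _ _ HK).
  (* This gives q b <= r / 8, the norm bound of the first iterate - v K(0, v); increments that halve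
     then sum to r / 4, well inside the bidisc of [K]. *)
  set (q := Rmin s (r / (8 * (b + 1)))).
  assert (Hq : (0 < q)%R).
  { apply Rmin_glb_lt; [exact Hs|]. apply Rdiv_lt_0_compat; lra. }
  assert (Hqs : (q <= s)%R) by apply Rmin_l.
  assert (Hqb : (q * b <= r / 8)%R).
  { assert (T : (q <= r / (8 * (b + 1)))%R) by apply Rmin_r.
    apply Rmult_le_compat_r with (r := (8 * (b + 1))%R) in T; [|lra].
    replace (r / (8 * (b + 1)) * (8 * (b + 1)))%R with r in T by (field; lra). nra. }
  clearbody q.
  set (gs := fix gs (k : nat) (v : C) : C :=
    match k with O => 0 | S k => - (1) * (v * K (gs k v) v) end).
  set (D := fun k v => gs (S k) v - gs k v).
  assert (Hgs0 : forall v, gs O v = 0) by reflexivity.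
  assert (HgsS : forall k v, gs (S k) v = - (1) * (v * K (gs k v) v)) by reflexivity.
  clearbody gs.
  assert (Hh : forall k, (0 < (1 / 2) ^ k <= 1)%R).
  { intros k. split; [apply pow_lt; lra|]. assert (T := pow_incr (1 / 2) 1 k ltac:(lra)).
    now rewrite pow1 in T. }
  assert (Hind : forall k, rep r q (r / 4 * (1 - (1 / 2) ^ k)) (fun _ v => gs k v) /\
    rep r q (r / 8 * (1 / 2) ^ k) (fun _ v => D k v)).
  { induction k as [|k [IH1 IH2]].
    - split.
      + apply (rep_ext r q _ (fun _ _ => 0)); [|intros; now rewrite Hgs0].
        apply (rep_le r q (Cmod 0)); [apply rep_const; lra|lra..|rewrite Cmod_0; simpl; lra].
      + apply (rep_ext r q _ (fun _ v => - (1) * (v * K 0 v))).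
        2:{ intros u v _ _. unfold D. rewrite HgsS, Hgs0. ring. }
        apply (rep_le r q (Cmod (- (1)) * (q * b))); [|lra..|rewrite Cmod_opp, Cmod_1; simpl; lra].
        apply (rep_scal _ _ _ (fun _ v => v * K 0 v)).
        apply (rep_mult_v _ _ _ (fun _ v => K 0 v)); [lra|].
        apply (rep_comp r s r q b (Cmod 0) q K (fun _ _ => 0) (fun _ v => v)); try lra; auto.
        * apply rep_const; lra.
        * apply rep_snd; lra.
        * rewrite Cmod_0. lra.
    - specialize (Hh k). split.
      + apply (rep_ext r q _ (fun _ v => gs k v + D k v)).
        2:{ intros u v _ _. unfold D. ring. }
        apply (rep_le r q (r / 4 * (1 - (1 / 2) ^ k) + r / 8 * (1 / 2) ^ k)); [|lra..|simpl; lra].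
        now apply (rep_plus _ _ _ _ (fun _ v => gs k v) (fun _ v => D k v)).
      (* [K] is expanded about the current iterate: K(gs k + w, v) = K(gs k, v) + w L(w, v) with [L]
         of norm at most 2 b / r. The new increment is thus at most 2 q b / r <= 1/4 times the old
         one. *)
      + assert (HB1 : rep (r / 2) q b (fun w v => K (gs k v + w) v)).
        { apply (rep_comp r s (r / 2) q b (r / 4 + r / 2) q K
            (fun w v => gs k v + w) (fun _ v => v)); try lra; auto.
          - apply (rep_plus _ _ _ _ (fun _ v => gs k v) (fun w _ => w)); [|apply rep_fst; lra].
            apply (rep_le r q (r / 4 * (1 - (1 / 2) ^ k))); [exact IH1|lra..|nra].
          - apply rep_snd; lra. }
        destruct (rep_divide_u (r / 2) q b _ ltac:(lra) ltac:(lra) HB1) as (L & HL & EL).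
        assert (HL' : rep r q (b / (r / 2)) (fun _ v => L (D k v) v)).
        { apply (rep_comp (r / 2) q r q _ (r / 8 * (1 / 2) ^ k) q L
            (fun _ v => D k v) (fun _ v => v)); try lra; auto; [|nra].
          apply rep_snd; lra. }
        apply (rep_ext r q _ (fun _ v => - (1) * (v * (D k v * L (D k v) v)))).
        * apply (rep_le r q (Cmod (- (1)) * (q * (r / 8 * (1 / 2) ^ k * (b / (r / 2))))));
            [|lra..|].
          -- apply (rep_scal _ _ _ (fun _ v => v * (D k v * L (D k v) v))).
             apply (rep_mult_v _ _ _ (fun _ v => D k v * L (D k v) v)); [lra|].
             now apply (rep_mult _ _ _ _ (fun _ v => D k v) (fun _ v => L (D k v) v)).
          -- rewrite Cmod_opp, Cmod_1. simpl.
             replace (1 * (q * (r / 8 * (1 / 2) ^ k * (b / (r / 2)))))%R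
               with ((q * b) / 4 * (1 / 2) ^ k)%R by (field; lra). nra.
        * intros u v _ Hv. unfold D at 3. rewrite (HgsS (S k)), (HgsS k).
          assert (HD : (Cmod (D k v) <= r / 2)%R).
          { eapply Rle_trans; [apply (rep_bound r q _ _ 0 v IH2); [rewrite Cmod_0; lra|exact Hv]|].
            nra. }
          assert (E := EL (D k v) v HD Hv). cbv beta in E. rewrite Cplus_0_r in E.
          replace (gs k v + D k v) with (gs (S k) v) in E by (unfold D; ring).
          rewrite <- (HgsS k), E. rewrite (HgsS k). ring. }
  assert (Hlim : forall v, exists l, (Cmod v <= q)%R -> slim (fun k => D k v) l).
  { intros v. destruct (Rle_dec (Cmod v) q) as [Hv|Hv]; [|exists 0; tauto].
    destruct (slim_ex (fun k => D k v) (r / 4)) as [l Hl]; [|now exists l].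
    intros N. apply Rle_trans with (sum_n (fun k => (r / 8 * (1 / 2) ^ k)%R) N).
    - apply rsum_le. intros k _. apply (rep_bound r q _ _ 0 v (proj2 (Hind k))); [|exact Hv].
      rewrite Cmod_0. lra.
    - rewrite rsum_mult_l, geom_sum by lra. specialize (Hh (S N)).
      replace ((1 - (1 / 2) ^ S N) / (1 - 1 / 2))%R with (2 * (1 - (1 / 2) ^ S N))%R by field. nra. }
  apply functional_choice in Hlim. destruct Hlim as [g Hg].
  assert (Hgrep : rep r q (r / 4) (fun _ v => g v)).
  { apply (rep_series r q _ (fun k => (r / 8 * (1 / 2) ^ k)%R) (fun k _ v => D k v)); auto.
    - intros k. apply Hind.
    - intros N. rewrite rsum_mult_l, geom_sum by lra. specialize (Hh (S N)).
      replace ((1 - (1 / 2) ^ S N) / (1 - 1 / 2))%R with (2 * (1 - (1 / 2) ^ S N))%R by field. nra. }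
  exists q, g. split; [lra|]. split; [exact Hgrep|]. intros v Hv.
  assert (HB : rep (r / 2) q B (fun w v => F (g v + w) v)).
  { apply (rep_comp r s (r / 2) q B (r / 4 + r / 2) q F
      (fun w v => g v + w) (fun _ v => v)); try lra; auto.
    - apply (rep_plus _ _ _ _ (fun _ v => g v) (fun w _ => w)); [|apply rep_fst; lra].
      apply (rep_le r q (r / 4)); [exact Hgrep|lra..].
    - apply rep_snd; lra. }
  destruct (rep_divide_u (r / 2) q B _ ltac:(lra) ltac:(lra) HB) as (L & HL & EL).
  set (BL := (B / (r / 2))%R) in *. assert (HBL := rep_nonneg _ _ _ _ HL).
  apply Cmod_eq_0. apply Rle_antisym; [|apply Cmod_ge_0].
  apply Rle_plus_epsilon. intros eps He.
  (* BL + 2 collects three errors: those of two successive iterates, and |w L(w, v)| <= BL |w|. The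
     bound r / 2 keeps w in the disc of [L]. *)
  set (e := Rmin (r / 2) (eps / (BL + 2))).
  assert (He0 : (0 < e)%R) by (apply Rmin_glb_lt; [lra|apply Rdiv_lt_0_compat; lra]).
  assert (He1 : (e <= r / 2)%R) by apply Rmin_l.
  assert (He2 : (e * (BL + 2) <= eps)%R).
  { assert (T : (e <= eps / (BL + 2))%R) by apply Rmin_r.
    apply Rmult_le_compat_r with (r := (BL + 2)%R) in T; [|lra].
    replace (eps / (BL + 2) * (BL + 2))%R with eps in T by (field; lra). exact T. }
  destruct (Hg v Hv e He0) as [N0 HN0].
  assert (Hc : forall k, (N0 <= k)%nat -> (Cmod (gs (S k) v - g v) < e)%R).
  { intros k Hk. specialize (HN0 k Hk). unfold D in HN0.
    rewrite (slim_telescope (fun k => gs k v)), Hgs0 in HN0.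
    replace (gs (S k) v - 0 - g v) with (gs (S k) v - g v) in HN0 by ring. exact HN0. }
  assert (H1 := Hc N0 ltac:(lia)). assert (H2 := Hc (S N0) ltac:(lia)).
  set (w := gs (S N0) v - g v) in *.
  assert (Ew := EL w v ltac:(lra) Hv). cbv beta in Ew. rewrite Cplus_0_r in Ew.
  replace (g v + w) with (gs (S N0) v) in Ew by (unfold w; ring).
  assert (Hbd : (Cmod (gs (S N0) v) <= r)%R).
  { eapply Rle_trans; [apply (rep_bound r q _ _ 0 v (proj1 (Hind (S N0))));
      [rewrite Cmod_0; lra|exact Hv]|]. specialize (Hh (S N0)). nra. }
  rewrite (EK _ v Hbd) in Ew by lra. rewrite (HF0 _ Hbd) in Ew.
  (* At an iterate F equals gs k + v K(gs k, v) = gs k - gs (k + 1), a difference of two errors; [L]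
     carries this from the iterate to the limit [g v]. *)
  assert (E : F (g v) v = (w - (gs (S (S N0)) v - g v)) - w * L w v).
  { replace (F (g v) v) with (F (g v) v + w * L w v - w * L w v) by ring. rewrite <- Ew.
    rewrite (HgsS (S N0)). unfold w. ring. }
  rewrite E. assert (HLb : (Cmod (L w v) <= BL)%R) by (apply (rep_bound _ _ _ _ w v HL); lra).
  assert (T1 := Cmod_sub_le (w - (gs (S (S N0)) v - g v)) 0 (w * L w v)).
  assert (T2 := Cmod_sub_le w 0 (gs (S (S N0)) v - g v)).
  replace (w - (gs (S (S N0)) v - g v) - 0) with (w - (gs (S (S N0)) v - g v)) in T1 by ring.
  replace (0 - w * L w v) with (- (w * L w v)) in T1 by ring. rewrite Cmod_opp, Cmod_mult in T1.
  replace (w - 0) with w in T2 by ring.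
  replace (0 - (gs (S (S N0)) v - g v)) with (- (gs (S (S N0)) v - g v)) in T2 by ring.
  rewrite Cmod_opp in T2.
  assert (HW := Cmod_ge_0 w). assert (HLw := Cmod_ge_0 (L w v)). nra.
Qed.

(** Shrinking the bidisc by t brings the norm of 1 - A down to 2 t B <= 1/2, so that [rep_geometric]
    applies to 1 - A; the same bound excludes zeros of [A]. *)
Lemma rep_inv r s B A : (0 < r)%R -> (0 < s)%R -> rep r s B A -> A 0 0 = 1 ->
  exists t, (0 < t <= 1)%R /\ rep (t * r) (t * s) 2 (fun u v => / A u v) /\
    forall u v, (Cmod u <= t * r)%R -> (Cmod v <= t * s)%R -> A u v <> 0.
Proof.
  intros Hr Hs HA HA0. assert (HB := rep_nonneg _ _ _ _ HA).
  set (t := Rmin 1 (/ (4 * B + 1))).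
  assert (Hq : (0 < / (4 * B + 1))%R) by (apply Rinv_0_lt_compat; lra).
  assert (Ht : (0 < t <= 1)%R) by (split; [apply Rmin_glb_lt; lra|apply Rmin_l]).
  assert (Hb : (t * (4 * B + 1) <= 1)%R).
  { assert (T : (t <= / (4 * B + 1))%R) by apply Rmin_r.
    apply Rmult_le_compat_r with (r := (4 * B + 1)%R) in T; [|lra].
    rewrite Rinv_l in T by lra. exact T. }
  exists t. split; [exact Ht|].
  assert (W := rep_scal _ _ _ _ (- (1)) (rep_sub_const r s B A t Hr Hs HA Ht)).
  rewrite Cmod_opp, Cmod_1 in W. cbv beta in W.
  split.
  - apply (rep_ext _ _ _ (fun u v => / (1 - - (1) * (A u v - A 0 0)))).
    + apply (rep_comp (1 / 2) 1 (t * r) (t * s) 2 (1 * (2 * t * B)) (Cmod 0) (fun x _ => / (1 - x))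
        (fun u v => - (1) * (A u v - A 0 0)) (fun _ _ => 0)); try nra.
      * apply rep_geometric. lra.
      * exact W.
      * apply rep_const; nra.
      * rewrite Cmod_0. lra.
    + intros u v _ _. rewrite HA0. f_equal. ring.
  - intros u v Hu Hv E. assert (T := rep_bound _ _ _ _ u v W Hu Hv). cbv beta in T.
    rewrite E, HA0 in T. replace (- (1) * (0 - 1)) with (RtoC 1) in T by ring.
    rewrite Cmod_1 in T. nra.
Qed.

(** The radii nest: |u| <= r/4 and |g| <= r/4 give |w| <= r/2 for w = u - g(v), and g + w, of norm
    at most 3r/4, stays in the bidisc of [F]. A last shrinking by t brings 1 / A into the
    algebra. *)
Lemma linear_factorization r s B F : (0 < r)%R -> (0 < s)%R -> rep r s B F ->
  (forall u, (Cmod u <= r)%R -> F u 0 = u) ->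
  exists p q g A Bg BA BI,
    (0 < p <= r)%R /\ (0 < q <= s)%R /\ rep p q Bg (fun _ v => g v) /\
    rep p q BA A /\ rep p q BI (fun u v => / A u v) /\ g 0 = 0 /\
    (forall u, (Cmod u <= p)%R -> A u 0 = 1) /\
    forall u v, (Cmod u <= p)%R -> (Cmod v <= q)%R ->
      A u v <> 0 /\ F u v = A u v * (u - g v).
Proof.
  intros Hr Hs HF HF0.
  destruct (implicit_function r s B F Hr Hs HF HF0) as (q & g & Hq & Hg & Hz).
  assert (Hgb : forall v, (Cmod v <= q)%R -> (Cmod (g v) <= r / 4)%R).
  { intros v Hv. apply (rep_bound r q _ _ 0 v Hg); [rewrite Cmod_0; lra|exact Hv]. }
  assert (C0 : (Cmod 0 <= q)%R) by (rewrite Cmod_0; lra).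
  assert (Hg0 : g 0 = 0).
  { rewrite <- (HF0 (g 0)); [now apply Hz|]. specialize (Hgb 0 C0). lra. }
  assert (HB : rep (r / 2) q B (fun w v => F (g v + w) v)).
  { apply (rep_comp r s (r / 2) q B (r / 4 + r / 2) q F
      (fun w v => g v + w) (fun _ v => v)); try lra; auto.
    - apply (rep_plus _ _ _ _ (fun _ v => g v) (fun w _ => w)); [|apply rep_fst; lra].
      apply (rep_le r q (r / 4)); [exact Hg|lra..].
    - apply rep_snd; lra. }
  destruct (rep_divide_u (r / 2) q B _ ltac:(lra) ltac:(lra) HB) as (L & HL & EL).
  set (A := fun u v => L (u + - (1) * g v) v).
  assert (HA : rep (r / 4) q (B / (r / 2)) A).
  { apply (rep_comp (r / 2) q (r / 4) q _ (r / 4 + Cmod (- (1)) * (r / 4)) q L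
      (fun u v => u + - (1) * g v) (fun _ v => v)); try lra; auto.
    - apply (rep_plus _ _ _ _ (fun u _ => u) (fun _ v => - (1) * g v)); [apply rep_fst; lra|].
      apply (rep_scal _ _ _ (fun _ v => g v)). apply (rep_le r q (r / 4)); [exact Hg|lra..].
    - apply rep_snd; lra.
    - rewrite Cmod_opp, Cmod_1. lra. }
  assert (HFA : forall u v, (Cmod u <= r / 4)%R -> (Cmod v <= q)%R ->
    F u v = A u v * (u - g v)).
  { intros u v Hu Hv. specialize (Hgb v Hv).
    assert (T := Cmod_triangle u (- g v)). rewrite Cmod_opp in T.
    assert (E := EL (u + - g v) v ltac:(lra) Hv). cbv beta in E.
    rewrite Cplus_0_r, (Hz v Hv) in E.
    replace (g v + (u + - g v)) with u in E by ring. rewrite E. unfold A.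
    replace (u + - (1) * g v) with (u + - g v) by ring. ring. }
  assert (HA1 : forall u, (Cmod u <= r / 4)%R -> u <> 0 -> A u 0 = 1).
  { intros u Hu Hu0. assert (E := HFA u 0 Hu C0). rewrite HF0, Hg0 in E by lra.
    replace (u - 0) with u in E by ring.
    replace (A u 0) with (A u 0 * u / u) by (field; exact Hu0). rewrite <- E. field. exact Hu0. }
  (* Cancelling u in u = A(u, 0) u requires u <> 0; the value at the centre follows by continuity,
     tested at a small positive real point. *)
  assert (HA0 : A 0 0 = 1).
  { destruct (Ceq_dec (A 0 0) 1) as [E|E]; [exact E|exfalso].
    assert (Hp : (0 < Cmod (1 - A 0 0))%R).
    { apply Cmod_gt_0. intros E'. apply E. replace (A 0 0) with (1 - (1 - A 0 0)) by ring.
      rewrite E'. ring. }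
    destruct (rep_cont (r / 4) q _ A _ ltac:(lra) ltac:(lra) HA Hp) as (d & Hd & Hcont).
    set (x := Rmin (d / 2) (r / 4)).
    assert (Hx : (0 < x)%R) by (apply Rmin_glb_lt; lra).
    assert (Hx1 : (x <= d / 2)%R) by apply Rmin_l. assert (Hx2 : (x <= r / 4)%R) by apply Rmin_r.
    specialize (Hcont (RtoC x) 0). rewrite Cmod_0, Cmod_RtoC_pos in Hcont by lra.
    rewrite HA1 in Hcont.
    - specialize (Hcont ltac:(lra) ltac:(lra)). lra.
    - rewrite Cmod_RtoC_pos; lra.
    - intros E'. apply RtoC_inj in E'. lra. }
  destruct (rep_inv (r / 4) q _ A ltac:(lra) ltac:(lra) HA HA0) as (t & Ht & HI & HN).
  exists (t * (r / 4))%R, (t * q)%R, g, A, (r / 4)%R, (B / (r / 2))%R, 2%R.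
  split; [nra|]. split; [nra|]. split; [apply (rep_le r q (r / 4)); [exact Hg|nra..]|].
  split; [apply (rep_le (r / 4) q (B / (r / 2))); [exact HA|nra..|lra]|].
  split; [exact HI|]. split; [exact Hg0|]. split.
  - intros u Hu. destruct (Ceq_dec u 0) as [->|Hu0]; [exact HA0|]. apply HA1; [nra|exact Hu0].
  - intros u v Hu Hv. split; [now apply HN|]. apply HFA; nra.
Qed.

(** * Entire power series, removable singularities, complex derivatives and the square root *)

Lemma entire2_sum (F : nat -> C -> C -> C) n : (forall k, entire2 (F k)) ->
  entire2 (fun u v => sum_n (fun k => F k u v) n).
Proof.
  intros H. induction n as [|n IH].
  - apply (entire2_ext (F O)); [intros; symmetry; apply csum_O|apply H].
  - apply (entire2_ext (fun u v => sum_n (fun k => F k u v) n + F (S n) u v)).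
    + intros. symmetry. apply csum_Sn.
    + now apply entire2_plus.
Qed.

Lemma exp_partial_sum x N : (0 <= x)%R ->
  (sum_n (fun k => / INR (fact k) * x ^ k) N <= exp x)%R.
Proof.
  intros Hx. rewrite sum_n_Reals. apply sum_incr.
  - unfold exp. destruct (exist_exp x) as [y Hy]. exact Hy.
  - intros k. apply Rmult_le_pos; [|now apply pow_le].
    left. apply Rinv_0_lt_compat, INR_fact_lt_0.
Qed.

(** Comparison with the exponential series bounds the norm by r^n exp r. The offset n serves the
    tail of y_l, which starts at l + 1. *)
Lemma entire2_CSeries (c : nat -> C) n : (forall k, (Cmod (c k) <= / INR (fact k))%R) ->
  entire2 (fun t _ => CSeries (fun k => c k * t ^ (n + k))).
Proof.
  intros Hc r Hr. exists (r ^ n * exp r)%R.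
  assert (Hrn : (0 < r ^ n)%R) by now apply pow_lt.
  assert (Hs : forall N, (sum_n (fun k => (Cmod (c k) * r ^ (n + k))%R) N <= r ^ n * exp r)%R).
  { intros N. eapply Rle_trans; [|apply Rmult_le_compat_l; [lra|apply (exp_partial_sum r N); lra]].
    rewrite <- rsum_mult_l. apply rsum_le. intros k _. rewrite pow_add.
    assert (Hk : (0 < r ^ k)%R) by now apply pow_lt.
    assert (T := Hc k).
    assert (Cmod (c k) * (r ^ n * r ^ k) <= / INR (fact k) * (r ^ n * r ^ k))%R
      by (apply Rmult_le_compat_r; nra). lra. }
  apply (rep_series r r _ (fun k => (Cmod (c k) * r ^ (n + k))%R)
    (fun k t _ => c k * t ^ (n + k))); auto.
  - intros k. apply (rep_mult _ _ _ _ (fun _ _ => c k) (fun t _ => t ^ (n + k))); auto.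
    + apply rep_const; lra.
    + apply (rep_pow r r r (fun t _ => t)); auto. apply rep_fst; lra.
  - intros t _ Ht _. destruct (slim_ex (fun k => c k * t ^ (n + k)) (r ^ n * exp r)) as [l Hl].
    + intros N. eapply Rle_trans; [|apply (Hs N)]. apply rsum_le. intros k _.
      rewrite Cmod_mult, Cmod_pow. apply Rmult_le_compat_l; [apply Cmod_ge_0|].
      apply pow_incr. split; [apply Cmod_ge_0|exact Ht].
    + now rewrite (slim_CSeries _ _ Hl).
Qed.

Lemma CSeries_ext a b : (forall k, a k = b k) -> CSeries a = CSeries b.
Proof.
  intros H. unfold CSeries. f_equal; apply Series_ext; intros k; now rewrite H.
Qed.

Lemma CSeries_at_0 (c : nat -> C) n :
  CSeries (fun k => c k * 0 ^ (n + k)) = match n with O => c O | S _ => 0 end.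
Proof.
  apply slim_CSeries. intros eps He. exists O. intros N _.
  assert (E : sum_n (fun k => c k * 0 ^ (n + k)) N = match n with O => c O | S _ => RtoC 0 end).
  { induction N as [|N IH].
    - rewrite csum_O. destruct n; simpl; cring.
    - rewrite csum_Sn, IH. replace (n + S N)%nat with (S (n + N)) by lia. simpl. destruct n; cring. }
  rewrite E. unfold Cminus. rewrite Cplus_opp_r. now rewrite Cmod_0.
Qed.

(** Balls of [C] as a product space are boxes; halving d absorbs the factor sqrt 2 between the
    modulus and the larger of the two components. *)
Lemma locally_Cmod (x : C) (P : C -> Prop) d : (0 < d)%R ->
  (forall y, (Cmod (y - x) < d)%R -> P y) -> locally x P.
Proof.
  intros Hd H. assert (Hd' : (0 < d / 2)%R) by lra. exists (mkposreal _ Hd'). intros y Hy.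
  apply H. assert (T := C_NormedModule_mixin_compat2 x y _ Hy).
  eapply Rlt_le_trans; [exact T|]. simpl.
  assert (Q : (sqrt 2 <= 2)%R).
  { rewrite <- (sqrt_square 2) at 2 by lra. apply sqrt_le_1; lra. }
  nra.
Qed.

Lemma locally_Cmod_inv (x : C) (P : C -> Prop) : locally x P ->
  exists d, (0 < d)%R /\ forall y, (Cmod (y - x) < d)%R -> P y.
Proof.
  intros [d Hd]. exists d. split; [apply cond_pos|]. intros y Hy. apply Hd.
  now apply C_NormedModule_mixin_compat1.
Qed.

(** Continuity of [h] at 0 identifies the limit in [remove_sing0] with h(0), so a removable
    singularity is settled by exhibiting an entire function equal to [g] off 0. *)
Lemma remove_sing0_entire (g h : C -> C) w : (forall w : C, w <> 0 -> g w = h w) ->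
  entire2 (fun w _ => h w) -> remove_sing0 g w = h w.
Proof.
  intros E Hh. unfold remove_sing0. destruct (Ceq_dec w 0) as [->|Hw]; [|now apply E].
  apply is_C_lim_unique. apply filterlim_locally. intros eps.
  destruct (Hh 1%R ltac:(lra)) as [B HB].
  destruct (rep_cont 1 1 B _ eps ltac:(lra) ltac:(lra) HB (cond_pos eps)) as (d & Hd & Hc).
  apply (locally_Cmod 0 _ d Hd). intros y Hy Hy0. rewrite (E y Hy0).
  apply C_NormedModule_mixin_compat1. apply (Hc y 0).
  - replace (y - 0) with y in Hy by ring. exact Hy.
  - rewrite Cmod_0. exact Hd.
Qed.

Notation is_Cderive := (is_derive (K := C_AbsRing) (V := C_NormedModule)).

(* Coquelicot has two normed-module structures on [C] over itself. *)
Lemma is_Cderive_AbsRing (f : C -> C) (x d : C) :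
  is_Cderive f x d <->
  is_derive (K := C_AbsRing) (V := AbsRing_NormedModule C_AbsRing) f x d.
Proof. split; intros [_ H]; (split; [apply is_linear_scal_l|exact H]). Qed.

Lemma is_Cderive_mult (f g : C -> C) (x df dg : C) : is_Cderive f x df -> is_Cderive g x dg ->
  is_Cderive (fun y => f y * g y) x (df * g x + f x * dg).
Proof.
  rewrite !is_Cderive_AbsRing. intros Hf Hg.
  exact (is_derive_mult (K := C_AbsRing) f g x df dg Hf Hg Cmult_comm).
Qed.

Lemma is_Cderive_comp (f g : C -> C) (x df dg : C) : is_Cderive f (g x) df -> is_Cderive g x dg ->
  is_Cderive (fun y => f (g y)) x (dg * df).
Proof.
  rewrite (is_Cderive_AbsRing g). intros Hf Hg.
  exact (is_derive_comp (K := C_AbsRing) (V := C_NormedModule) f g x df dg Hf Hg).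
Qed.

Lemma is_Cderive_pow n (x : C) : is_Cderive (fun y => y ^ S n) x (INR (S n) * x ^ n).
Proof.
  induction n as [|n IH].
  - apply (is_derive_ext (K := C_AbsRing) (V := C_NormedModule) (fun y : C => y)).
    + intros. symmetry. apply Cmult_1_r.
    + simpl. rewrite Cmult_1_l. apply is_Cderive_AbsRing; exact (is_derive_id (K := C_AbsRing) x).
  - replace (INR (S (S n)) * x ^ S n) with (1 * x ^ S n + x * (INR (S n) * x ^ n)).
    + apply (is_Cderive_mult (fun y => y) (fun y => y ^ S n)); [|exact IH].
      apply is_Cderive_AbsRing; exact (is_derive_id (K := C_AbsRing) x).
    + rewrite (S_INR (S n)), RtoC_plus. simpl (x ^ S n). ring.
Qed.

(** The remainder is exactly w^2 / (x^2 (x + w)), and |w| <= |x| / 2 keeps |x + w| >= |x| / 2,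
    whence the constant 2 / |x|^3. *)
Lemma is_Cderive_inv (x : C) : x <> 0 -> is_Cderive Cinv x (- / (x * x)).
Proof.
  intros Hx. assert (Hp : (0 < Cmod x)%R) by now apply Cmod_gt_0.
  apply (is_derive_quadratic _ _ _ (Cmod x / 2) (2 / (Cmod x * Cmod x * Cmod x))%R); [lra|].
  intros w Hw.
  assert (T := Cmod_triangle (x + w) (- w)). rewrite Cmod_opp in T.
  replace (x + w + - w) with x in T by ring.
  assert (Hxw : x + w <> 0) by (apply Cmod_gt_0; lra).
  replace (/ (x + w) - / x - w * - / (x * x)) with (w ^ 2 / (x * x * (x + w)))
    by (field; auto).
  rewrite Cmod_div, !Cmod_mult, Cmod_pow by (repeat apply Cmult_neq_0; auto).
  unfold Rdiv. rewrite Rmult_comm. apply Rmult_le_compat_r; [apply pow_le, Cmod_ge_0|].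
  replace (2 * / (Cmod x * Cmod x * Cmod x))%R with (/ (Cmod x * Cmod x * (Cmod x / 2)))%R
    by (field; lra).
  apply Rinv_le_contravar; [apply Rmult_lt_0_compat; nra|apply Rmult_le_compat_l; nra].
Qed.

(** With p and q the real roots of (|z| + x) / 2 and (|z| - x) / 2, p^2 - q^2 = x and 2 p q = |y|;
    the sign in [Csqrt] turns |y| into y. This holds on the branch cut as well. *)
Lemma Csqrt_sqr z : Csqrt z ^ 2 = z.
Proof.
  destruct z as [x y].
  assert (Hm : (Cmod (x, y) * Cmod (x, y) = x * x + y * y)%R).
  { unfold Cmod. rewrite sqrt_sqrt; simpl; nra. }
  assert (H0 := Cmod_ge_0 (x, y)).
  assert (H1 := re_le_Cmod (x, y)). simpl in H1.
  assert (H2 := Rle_abs x). assert (H3 := Rle_abs (- x)). rewrite Rabs_Ropp in H3.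
  unfold Csqrt. change (Re (x, y)) with x. change (Im (x, y)) with y.
  set (m := Cmod (x, y)) in *.
  assert (Hp : (0 <= (m + x) / 2)%R) by lra. assert (Hn : (0 <= (m - x) / 2)%R) by lra.
  assert (Ep := sqrt_sqrt _ Hp). assert (En := sqrt_sqrt _ Hn).
  assert (Epn : (sqrt ((m + x) / 2) * sqrt ((m - x) / 2) = Rabs y / 2)%R).
  { rewrite <- sqrt_mult by lra.
    replace ((m + x) / 2 * ((m - x) / 2))%R with (Rsqr (y / 2)) by (unfold Rsqr; nra).
    rewrite sqrt_Rsqr_abs. unfold Rdiv. rewrite Rabs_mult, (Rabs_pos_eq (/ 2)); lra. }
  set (p := sqrt ((m + x) / 2)) in *. set (q := sqrt ((m - x) / 2)) in *.
  destruct (Rlt_dec y 0) as [Hy|Hy].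
  - rewrite Rabs_left in Epn by exact Hy. simpl. unfold Cmult; simpl. f_equal; nra.
  - rewrite Rabs_pos_eq in Epn by lra. simpl. unfold Cmult; simpl. f_equal; nra.
Qed.

Lemma Csqrt_neq_0 (z : C) : z <> 0 -> Csqrt z <> 0.
Proof. intros Hz E. apply Hz. rewrite <- (Csqrt_sqr z), E. simpl. ring. Qed.
(** * The Mie denominator *)

Definition sphj_coef (l k : nat) : C := (- / 2) ^ k / (INR (fact k) * INR (odd_fact (l + k + 1))).

Definition sphy_coef (l j : nat) : C :=
  (- / 2) ^ (l + 1 + j) / (INR (fact (l + 1 + j)) * INR (odd_fact (j + 1))).

(** This is z^(-l) j_l(z) as a function of t = z^2. The exponent [0 + k] matches [entire2_CSeries]
    with offset 0. *)
Definition sphj_red (l : nat) (t : C) : C := CSeries (fun k => sphj_coef l k * t ^ (0 + k)).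

(** Together with [sphy_head] this encodes z^(l+1) y_l(z) in t = z^2, as - head + (-1)^(l+1)
    tail. *)
Definition sphy_tail (l : nat) (t : C) : C :=
  CSeries (fun j => sphy_coef l j * t ^ (l + 1 + j)).

Definition sphy_head (l : nat) (t : C) : C :=
  sum_n (fun k => INR (odd_fact (l - k)) * (t / 2) ^ k / INR (fact k)) l.

(* w^l xi_l(w), entire in w. *)
Definition xi_red (l : nat) (w : C) : C :=
  w ^ (2 * l + 1) * sphj_red l (w ^ 2)
  + Ci * (- sphy_head l (w ^ 2) + (-1) ^ (l + 1) * sphy_tail l (w ^ 2)).

(* w^(l+1) xi_l'(w) *)
Definition xi_red1 (l : nat) (w : C) : C := w * C_derive (xi_red l) w - INR l * xi_red l w.

(* w^(-l) psi_l'(w), as a function of w^2. *)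
Definition psi_red1 (l : nat) (t : C) : C :=
  (INR l + 1) * sphj_red l t + 2 * t * C_derive (sphj_red l) t.

Lemma odd_fact_pos n : (1 <= odd_fact n)%nat.
Proof. induction n as [|n IH]; simpl; nia. Qed.

Lemma INR_odd_fact_neq_0 n : RtoC (INR (odd_fact n)) <> 0.
Proof.
  intros E. apply RtoC_inj in E. assert (T := odd_fact_pos n). apply le_INR in T. simpl in T. lra.
Qed.

Lemma INR_fact_neq_0C n : RtoC (INR (fact n)) <> 0.
Proof. intros E. apply RtoC_inj in E. now apply (INR_fact_neq_0 n). Qed.

(** The power of 1/2 is at most 1 and the double factorial at least 1. Independent indices let the
    estimate cover both j_l and y_l. *)
Lemma bessel_coef_le m p q :
  (Cmod ((- / 2) ^ m / (INR (fact p) * INR (odd_fact q))) <= / INR (fact p))%R.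
Proof.
  assert (Hf := INR_fact_lt_0 p).
  assert (Ho : (1 <= INR (odd_fact q))%R) by (apply (le_INR 1), odd_fact_pos).
  rewrite Cmod_div by (apply Cmult_neq_0; [apply INR_fact_neq_0C|apply INR_odd_fact_neq_0]).
  rewrite Cmod_mult, !Cmod_RtoC_pos, Cmod_pow, Cmod_opp, <- RtoC_inv, Cmod_RtoC_pos by lra.
  assert (Hh : (0 <= (/ 2) ^ m <= 1)%R).
  { split; [apply pow_le; lra|]. assert (T := pow_incr (/ 2) 1 m ltac:(lra)).
    now rewrite pow1 in T. }
  apply Rmult_le_reg_r with (INR (fact p) * INR (odd_fact q))%R; [nra|].
  unfold Rdiv. rewrite Rmult_assoc, Rinv_l, <- Rmult_assoc, Rinv_l by nra. lra.
Qed.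

Lemma entire2_sphj_red l : entire2 (fun t _ => sphj_red l t).
Proof. apply (entire2_CSeries (sphj_coef l) 0). intros k. apply bessel_coef_le. Qed.

Lemma entire2_sphy_tail l : entire2 (fun t _ => sphy_tail l t).
Proof.
  apply (entire2_CSeries (sphy_coef l) (l + 1)). intros k.
  eapply Rle_trans; [apply bessel_coef_le|].
  apply Rinv_le_contravar; [apply INR_fact_lt_0|]. apply le_INR, fact_le. lia.
Qed.

Lemma entire2_sphy_head l : entire2 (fun t _ => sphy_head l t).
Proof.
  apply (entire2_sum (fun k t _ => INR (odd_fact (l - k)) * (t / 2) ^ k / INR (fact k))).
  intros k. apply entire2_mult; [|apply entire2_const].
  apply entire2_mult; [apply entire2_const|]. apply entire2_pow.
  apply entire2_mult; [apply entire2_fst|apply entire2_const].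
Qed.

Lemma entire2_comp1 (h : C -> C) U : entire2 (fun t _ => h t) -> entire2 U ->
  entire2 (fun u v => h (U u v)).
Proof. intros Hh HU. exact (entire2_comp _ U (fun _ _ => 0) Hh HU (entire2_const 0)). Qed.

Lemma entire2_xi_red l : entire2 (fun w _ => xi_red l w).
Proof.
  assert (H2 : entire2 (fun w _ => w ^ 2)) by apply entire2_pow, entire2_fst.
  apply entire2_plus; apply entire2_mult.
  - apply entire2_pow, entire2_fst.
  - apply entire2_comp1; [apply entire2_sphj_red|exact H2].
  - apply entire2_const.
  - apply entire2_plus.
    + apply (entire2_ext (fun w _ => - (1) * sphy_head l (w ^ 2))); [intros; ring|].
      apply entire2_mult; [apply entire2_const|].
      apply entire2_comp1; [apply entire2_sphy_head|exact H2].
    + apply entire2_mult; [apply entire2_const|].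
      apply entire2_comp1; [apply entire2_sphy_tail|exact H2].
Qed.

Lemma entire2_xi_red1 l : entire2 (fun w _ => xi_red1 l w).
Proof.
  apply (entire2_ext (fun w _ => w * C_derive (xi_red l) w + - INR l * xi_red l w)).
  { intros. unfold xi_red1. ring. }
  apply entire2_plus; apply entire2_mult.
  - apply entire2_fst.
  - apply entire_derive, entire2_xi_red.
  - apply entire2_const.
  - apply entire2_xi_red.
Qed.

Lemma entire2_psi_red1 l : entire2 (fun t _ => psi_red1 l t).
Proof.
  apply entire2_plus; apply entire2_mult.
  - apply entire2_const.
  - apply entire2_sphj_red.
  - apply entire2_mult; [apply entire2_const|apply entire2_fst].
  - apply entire_derive, entire2_sphj_red.
Qed.

Lemma sph_j_red l z : sph_j l z = z ^ l * sphj_red l (z ^ 2).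
Proof.
  unfold sph_j, sphj_red. f_equal. apply CSeries_ext. intros k. unfold sphj_coef. simpl (0 + k)%nat.
  replace (- (z ^ 2 / 2)) with (- / 2 * z ^ 2) by field. rewrite Cpow_mult_l.
  field. split; [apply INR_odd_fact_neq_0|apply INR_fact_neq_0C].
Qed.

Lemma psi_red l z : psi l z = z ^ S l * sphj_red l (z ^ 2).
Proof. unfold psi. rewrite sph_j_red. simpl. ring. Qed.

(** The factor z in xi_l leaves the y_l part with a pole of order l; clearing z^l removes it and
    raises the j_l part to z^(2l+1). *)
Lemma xi_xi_red l (z : C) : z <> 0 -> xi l z = xi_red l z * / z ^ l.
Proof.
  intros Hz. unfold xi, sph_h1. rewrite sph_j_red. unfold sph_y, xi_red, sphy_head.
  replace (CSeries _) with (sphy_tail l (z ^ 2)).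
  2:{ apply CSeries_ext. intros j. unfold sphy_coef.
      replace (- (z ^ 2 / 2)) with (- / 2 * z ^ 2) by field. rewrite Cpow_mult_l.
      field. split; [apply INR_odd_fact_neq_0|apply INR_fact_neq_0C]. }
  replace (2 * l + 1)%nat with (l + l + 1)%nat by lia.
  rewrite !Cpow_add_r, Cpow_1_r. field. repeat split; auto using Cpow_nz.
Qed.

Lemma C_derive_psi l z : C_derive (psi l) z = z ^ l * psi_red1 l (z ^ 2).
Proof.
  apply is_C_derive_unique.
  apply (is_derive_ext (K := C_AbsRing) (V := C_NormedModule)
    (fun z => z ^ S l * sphj_red l (z ^ 2))); [intros; symmetry; apply psi_red|].
  replace (z ^ l * psi_red1 l (z ^ 2)) with
    (INR (S l) * z ^ l * sphj_red l (z ^ 2) +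
     z ^ S l * (INR 2 * z ^ 1 * C_derive (sphj_red l) (z ^ 2))).
  - apply (is_Cderive_mult (fun z => z ^ S l) (fun z => sphj_red l (z ^ 2))).
    + apply is_Cderive_pow.
    + apply (is_Cderive_comp (sphj_red l) (fun z => z ^ 2)).
      * apply entire_derive, entire2_sphj_red.
      * apply is_Cderive_pow.
  - unfold psi_red1. rewrite S_INR, RtoC_plus. replace (INR 2) with 2%R by (simpl; lra).
    simpl. ring.
Qed.

Lemma C_derive_xi l (z : C) : (1 <= l)%nat -> z <> 0 ->
  z ^ (l + 1) * C_derive (xi l) z = xi_red1 l z.
Proof.
  intros Hl Hz. destruct l as [|n]; [lia|].
  set (d := C_derive (xi_red (S n)) z * / z ^ S n
    + xi_red (S n) z * (INR (S n) * z ^ n * - / (z ^ S n * z ^ S n))).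
  assert (Hd : C_derive (xi (S n)) z = d).
  { apply is_C_derive_unique.
    apply (is_derive_ext_loc (K := C_AbsRing) (V := C_NormedModule)
      (fun z => xi_red (S n) z * / z ^ S n)).
    (* [xi_xi_red] is available off 0 only, and the disc of radius |z| about z avoids 0. *)
    - assert (Hp : (0 < Cmod z)%R) by now apply Cmod_gt_0.
      exists (mkposreal _ Hp). intros y Hy. symmetry. apply xi_xi_red. intros ->.
      change (Cmod (0 - z) < Cmod z)%R in Hy.
      replace (0 - z) with (- z) in Hy by ring. rewrite Cmod_opp in Hy. lra.
    - apply (is_Cderive_mult (xi_red (S n)) (fun z => / z ^ S n)).
      + apply entire_derive, entire2_xi_red.
      + apply (is_Cderive_comp Cinv (fun z => z ^ S n)).
        * exact (is_Cderive_inv (z ^ S n) (Cpow_nz _ _ Hz)).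
        * apply is_Cderive_pow. }
  rewrite Hd. unfold d, xi_red1. rewrite Cpow_add_r, Cpow_1_r. simpl (z ^ S n).
  field. repeat split; auto using Cpow_nz.
Qed.

(** [Csqrt_sqr] turns x^2 into z^2 e and so removes the branch cut in e. The root of eb stays, as a
    constant. *)
Lemma mie_f_red l eb e z : (1 <= l)%nat ->
  mie_f l eb e z = (2 * INR l + 1) / INR l *
    (Ci * xi_red l (z * Csqrt eb) * psi_red1 l (z ^ 2 * e) * eb
     - Ci * sphj_red l (z ^ 2 * e) * xi_red1 l (z * Csqrt eb) * e).
Proof.
  intros Hl. unfold mie_f.
  assert (E2 : (z * Csqrt e) ^ 2 = z ^ 2 * e) by now rewrite Cpow_mult_l, Csqrt_sqr.
  assert (H2 : entire2 (fun w _ => w ^ 2)) by apply entire2_pow, entire2_fst.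
  rewrite (remove_sing0_entire _ (xi_red l)).
  2:{ intros w Hw. rewrite xi_xi_red by exact Hw. field. now apply Cpow_nz. }
  2:{ apply entire2_xi_red. }
  rewrite (remove_sing0_entire _ (fun w => psi_red1 l (w ^ 2))).
  2:{ intros w Hw. rewrite C_derive_psi. field. now apply Cpow_nz. }
  2:{ apply (entire2_comp1 (psi_red1 l)); [apply entire2_psi_red1|exact H2]. }
  rewrite (remove_sing0_entire _ (fun w => sphj_red l (w ^ 2))).
  2:{ intros w Hw. rewrite psi_red. replace (l + 1)%nat with (S l) by lia. field.
      now apply Cpow_nz. }
  2:{ apply (entire2_comp1 (sphj_red l)); [apply entire2_sphj_red|exact H2]. }
  rewrite (remove_sing0_entire _ (xi_red1 l)).
  2:{ intros w Hw. now apply C_derive_xi. }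
  2:{ apply entire2_xi_red1. }
  now rewrite E2.
Qed.

Lemma entire2_mie_f l eb : (1 <= l)%nat -> entire2 (mie_f l eb).
Proof.
  intros Hl.
  assert (Ht : entire2 (fun e z => z ^ 2 * e)).
  { apply entire2_mult; [apply entire2_pow, entire2_snd|apply entire2_fst]. }
  assert (Hw : entire2 (fun _ z => z * Csqrt eb)).
  { apply entire2_mult; [apply entire2_snd|apply entire2_const]. }
  apply (entire2_ext (fun e z => (2 * INR l + 1) / INR l *
    (Ci * xi_red l (z * Csqrt eb) * psi_red1 l (z ^ 2 * e) * eb
     + - Ci * sphj_red l (z ^ 2 * e) * xi_red1 l (z * Csqrt eb) * e))).
  { intros e z. rewrite mie_f_red by exact Hl. f_equal. ring. }
  apply entire2_mult; [apply entire2_const|].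
  apply entire2_plus; (apply entire2_mult; [|first [apply entire2_const|apply entire2_fst]]);
    (apply entire2_mult; [apply entire2_mult; [apply entire2_const|]|]).
  - apply (entire2_comp1 (xi_red l)); [apply entire2_xi_red|exact Hw].
  - apply (entire2_comp1 (psi_red1 l)); [apply entire2_psi_red1|exact Ht].
  - apply (entire2_comp1 (sphj_red l)); [apply entire2_sphj_red|exact Ht].
  - apply (entire2_comp1 (xi_red1 l)); [apply entire2_xi_red1|exact Hw].
Qed.

Lemma INR_neq_0C l : (1 <= l)%nat -> RtoC (INR l) <> 0.
Proof. intros Hl E. apply RtoC_inj in E. apply le_INR in Hl. simpl in Hl. lra. Qed.

Lemma INR_2l1_neq_0C l : 2 * INR l + 1 <> 0.
Proof.
  rewrite <- RtoC_mult, <- RtoC_plus. intros E. apply RtoC_inj in E.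
  assert (T := pos_INR l). lra.
Qed.

Lemma Ci_sqr : Ci * Ci = - (1).
Proof. unfold Ci, Cmult, Copp; simpl. apply injective_projections; simpl; ring. Qed.

Lemma sphy_head_0 l : sphy_head l 0 = INR (odd_fact l).
Proof.
  unfold sphy_head. generalize l at 2. intros n. induction n as [|n IH].
  - rewrite csum_O. simpl. rewrite Nat.sub_0_r. cfield.
  - rewrite csum_Sn, IH. replace (0 / 2) with (RtoC 0) by field. rewrite Cpow_S.
    unfold Cdiv. ring.
Qed.

(** At 0, x^(-l-1) psi_l is 1 / (2l+1)!!, x^(-l) psi_l' is (l+1) / (2l+1)!!, x^l xi_l is - i
    (2l-1)!! and x^(l+1) xi_l' is i l (2l-1)!!. *)
Lemma mie_f_at_0 l eb e : (1 <= l)%nat -> mie_f l eb e 0 = e - eps_res l eb.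
Proof.
  intros Hl. rewrite mie_f_red by exact Hl.
  assert (Hl0 := INR_neq_0C l Hl).
  replace (0 * Csqrt eb) with (RtoC 0) by ring.
  replace (0 ^ 2 * e) with (RtoC 0) by (simpl; ring).
  assert (Ho := INR_odd_fact_neq_0 l). assert (H21 := INR_2l1_neq_0C l).
  assert (Ej : sphj_red l 0 = / ((2 * INR l + 1) * INR (odd_fact l))).
  { unfold sphj_red. rewrite (CSeries_at_0 _ 0). unfold sphj_coef.
    replace (l + 0 + 1)%nat with (S l) by lia.
    change (odd_fact (S l)) with ((2 * l + 1) * odd_fact l)%nat.
    rewrite mult_INR, plus_INR, mult_INR. simpl (INR 2). simpl (INR (fact 0)). simpl (INR 1).
    rewrite RtoC_mult, !RtoC_plus, RtoC_mult, RtoC_plus.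
    change ((- / 2) ^ 0) with (RtoC 1). field. auto. }
  assert (Ex : xi_red l 0 = - Ci * INR (odd_fact l)).
  { unfold xi_red. replace (0 ^ 2) with (RtoC 0) by (simpl; ring).
    rewrite sphy_head_0. unfold sphy_tail. rewrite (CSeries_at_0 _ (l + 1)).
    replace (l + 1)%nat with (S l) by lia. replace (2 * l + 1)%nat with (S (2 * l)) by lia.
    cbv beta iota. rewrite (Cpow_S 0). ring. }
  unfold psi_red1, xi_red1. rewrite Ej, Ex. unfold eps_res.
  transitivity (- (Ci * Ci) * (e - - ((INR l + 1) / INR l * eb))).
  - field. auto.
  - rewrite Ci_sqr. ring.
Qed.

Lemma mie_r2_red l (eb e z : C) : (1 <= l)%nat -> eb <> 0 -> e <> 0 -> z <> 0 ->
  mie_f l eb e z <> 0 ->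
  mie_r2 l eb e z = (2 * INR l + 1) / INR l
    * (Csqrt eb ^ (l + 1) / Csqrt e ^ (l - 1)) * (1 / mie_f l eb e z).
Proof.
  intros Hl Heb He Hz. rewrite mie_f_red by exact Hl. unfold mie_r2.
  assert (Hb := Csqrt_neq_0 eb Heb). assert (Hs := Csqrt_neq_0 e He).
  assert (Eb := Csqrt_sqr eb). assert (Es := Csqrt_sqr e).
  assert (Hxb : z * Csqrt eb <> 0) by now apply Cmult_neq_0.
  assert (Hxi : C_derive (xi l) (z * Csqrt eb)
    = xi_red1 l (z * Csqrt eb) / (z * Csqrt eb) ^ (l + 1)).
  { rewrite <- C_derive_xi by assumption. field. now apply Cpow_nz. }
  rewrite Hxi, xi_xi_red, C_derive_psi, psi_red by assumption.
  replace ((z * Csqrt e) ^ 2) with (z ^ 2 * e) by now rewrite Cpow_mult_l, Es.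
  set (X := xi_red l (z * Csqrt eb)). set (Y := xi_red1 l (z * Csqrt eb)).
  set (P := psi_red1 l (z ^ 2 * e)). set (J := sphj_red l (z ^ 2 * e)).
  set (b := Csqrt eb) in *. set (s := Csqrt e) in *.
  intros Hf.
  set (T := Ci * X * P * eb - Ci * J * Y * e) in *.
  assert (HT : T <> 0) by (intros E; apply Hf; rewrite E; ring).
  assert (H21 := INR_2l1_neq_0C l). assert (Hl0 := INR_neq_0C l Hl).
  destruct l as [|n]; [lia|]. replace (S n - 1)%nat with n by lia.
  replace (S n + 1)%nat with (S (S n)) in * by lia.
  assert (HCi : Ci <> 0).
  { intros E. assert (T' := Ci_sqr). rewrite E in T'. apply Hz.
    replace z with (- - (1) * z) by ring. rewrite <- T'. ring. }
  assert (Hzn := Cpow_nz z n Hz). assert (Hbn := Cpow_nz b n Hb). assert (Hsn := Cpow_nz s n Hs).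
  (* In each product the two Riccati-Bessel factors carry opposite powers of z, which cancel: the
     denominator is (s / b)^l T / (i eb), with T the bracket of [mie_f]. *)
  replace (X * / (z * b) ^ S n * ((z * s) ^ S n * P)
    - s / b * ((z * s) ^ S (S n) * J) * (Y / (z * b) ^ S (S n)))
    with (T * (s * s ^ n) / (Ci * eb * (b * b ^ n))).
  2:{ unfold T. rewrite <- Eb, <- Es, !Cpow_mult_l. simpl. field. auto 10. }
  (* [field] treats i as an indeterminate, so the factor - i^2 is kept apart and evaluated last. *)
  transitivity (- (Ci * Ci) * (b * (b * b ^ n) / s ^ n / T)).
  - rewrite <- Eb. simpl. field. auto 10.
  - rewrite Ci_sqr. simpl. field. auto 10.
Qed.

(** * From the analyticity predicates back to the algebra; equality of germs *)

Lemma filterlim_slim (f : nat -> C) (l : C) : filterlim (sum_n f) eventually (locally l) ->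
  slim f l.
Proof.
  intros H eps He. apply (H (fun y => (Cmod (y - l) < eps)%R)).
  now apply (locally_Cmod l _ eps).
Qed.

(** Convergence at the point r / 2 bounds the terms there by some M, so at radius r / 4 the norms
    are dominated by M 2^-k. The first radius 1 is arbitrary, since only v occurs. *)
Lemma analytic_at_rep h p : analytic_at h p ->
  exists s B, (0 < s)%R /\ rep 1 s B (fun _ v => h (p + v)).
Proof.
  intros (a & r & H). assert (Hr := cond_pos r).
  assert (Hs : forall v, (Cmod v < r)%R -> slim (fun k => a k * v ^ k) (h (p + v))).
  { intros v Hv. apply filterlim_slim.
    assert (E : forall x y : C, x + y - x = y) by (intros; ring).
    specialize (H (p + v)). rewrite E in H. specialize (H Hv).
    eapply filterlim_ext; [|exact H]. intros N. apply sum_n_ext. intros k.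
    change (pow_n (K := C_Ring) v k * a k = a k * v ^ k). rewrite pow_n_Cpow. ring. }
  assert (Hr2 : (Cmod (RtoC (r / 2)) < r)%R) by (rewrite Cmod_RtoC_pos; lra).
  destruct (Hs _ Hr2 1%R ltac:(lra)) as [N0 HN0].
  set (l := h (p + RtoC (r / 2))) in *.
  set (T := fun k => Cmod (a k * RtoC (r / 2) ^ k)).
  assert (HT : forall k, (0 <= T k)%R) by (intros; apply Cmod_ge_0).
  (* Terms up to [N0] are below the partial sum; a later one is a difference of two partial sums,
     each within 1 of the limit, hence the 2. *)
  set (M := (sum_n T N0 + 2)%R).
  assert (HM0 : (0 <= sum_n T N0)%R) by (apply rsum_nonneg; auto).
  assert (HM : forall k, (T k <= M)%R).
  { intros k. destruct (Compare_dec.le_lt_dec k N0) as [Hk|Hk].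
    - assert (T k <= sum_n T k)%R.
      { destruct k; [rewrite rsum_O; lra|]. rewrite rsum_Sn.
        assert (0 <= sum_n T k)%R by (apply rsum_nonneg; auto). lra. }
      assert (sum_n T k <= sum_n T N0)%R by (apply rsum_mono; auto). unfold M. lra.
    - destruct k; [lia|].
      assert (H1 := HN0 k ltac:(lia)). assert (H2 := HN0 (S k) ltac:(lia)).
      rewrite csum_Sn in H2. unfold T.
      set (x := a (S k) * RtoC (r / 2) ^ S k) in *.
      set (y := sum_n (fun k => a k * RtoC (r / 2) ^ k) k) in *.
      assert (T' := Cmod_triangle (y + x - l) (- (y - l))). rewrite Cmod_opp in T'.
      replace (y + x - l + - (y - l)) with x in T' by cring. unfold M. lra. }
  exists (r / 4)%R, (2 * M)%R. split; [lra|].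
  apply (rep_series _ _ _ (fun k => (M * (1 / 2) ^ k)%R) (fun k _ v => a k * v ^ k)); [lra|lra|..].
  - intros k. apply (rep_le 1 (r / 4) (Cmod (a k) * (r / 4) ^ k)); [|lra..|].
    + apply (rep_scal _ _ _ (fun _ v => v ^ k)).
      apply (rep_pow _ _ _ (fun _ v => v)); try lra. apply rep_snd; lra.
    + replace (r / 4)%R with (r / 2 * (1 / 2))%R by field. rewrite Rpow_mult_distr.
      rewrite <- Rmult_assoc. apply Rmult_le_compat_r; [apply pow_le; lra|].
      eapply Rle_trans; [|apply (HM k)]. unfold T. rewrite Cmod_mult, Cmod_pow, Cmod_RtoC_pos; lra.
  - intros N. rewrite rsum_mult_l, geom_sum by lra.
    assert (0 < (1 / 2) ^ S N)%R by (apply pow_lt; lra).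
    replace ((1 - (1 / 2) ^ S N) / (1 - 1 / 2))%R with (2 * (1 - (1 / 2) ^ S N))%R by field.
    unfold M. nra.
  - intros u v _ Hv. apply Hs. lra.
Qed.

Lemma rep_cont1 (h : C -> C) p s B eps : (0 < s)%R -> rep 1 s B (fun _ v => h (p + v)) ->
  (0 < eps)%R -> exists d, (0 < d)%R /\
    forall z, (Cmod (z - p) < d)%R -> (Cmod (h z - h p) < eps)%R.
Proof.
  intros Hs HB He.
  destruct (rep_cont 1 s B _ eps ltac:(lra) Hs HB He) as (d & Hd & Hc).
  exists d. split; [exact Hd|]. intros z Hz.
  specialize (Hc 0 (z - p)). rewrite Cmod_0 in Hc. specialize (Hc Hd Hz).
  replace (p + (z - p)) with z in Hc by ring. replace (p + 0) with p in Hc by ring. exact Hc.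
Qed.

(** Absolute summability gives a limit over all rectangles, and the square sums identify it with
    [G]. Halving r passes from the open bidisc to a closed one. *)
Lemma analytic2_at_rep G u0 v0 : analytic2_at G u0 v0 ->
  exists r B, (0 < r)%R /\ rep r r B (fun u v => G (u0 + u) (v0 + v)).
Proof.
  intros (a & r & [M HM] & H). assert (Hr := cond_pos r).
  assert (HB : forall K L, (dabs (mono a r r) K L <= M)%R).
  { intros K L. eapply Rle_trans; [apply (dabs_mono _ K L (max K L) (max K L)); lia|].
    eapply Rle_trans; [|apply (HM (max K L))]. apply Req_le.
    apply sum_n_ext. intros m. apply sum_n_ext. intros n.
    rewrite Cmod_mono_pos, pow_add by lra. apply Rmult_assoc. }
  exists (r / 2)%R, M. split; [lra|]. exists a. split.
  - intros K L. eapply Rle_trans; [|apply (HB K L)].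
    apply dabs_mono_le; rewrite Cmod_RtoC_pos; lra.
  - intros u v Hu Hv. destruct (dlim_ex (mono a u v) M) as [l Hl].
    { intros K L. eapply Rle_trans; [|apply (HB K L)]. apply dabs_mono_le; lra. }
    assert (E : forall x y : C, x + y - x = y) by (intros; ring).
    specialize (H (u0 + u) (v0 + v)). rewrite !E in H. specialize (H ltac:(lra) ltac:(lra)).
    replace (G (u0 + u) (v0 + v)) with l; [exact Hl|].
    apply (filterlim_locally_unique (K := C_AbsRing) (V := C_NormedModule)
      (F := eventually) (fun N => dsum (mono a u v) N N)); [|exact H].
    apply filterlim_locally. intros eps.
    destruct (Hl eps (cond_pos eps)) as [N0 HN0]. exists N0. intros N HN.
    apply C_NormedModule_mixin_compat1. now apply HN0.
Qed.

Lemma analytic2_at_cont G u0 v0 eps : analytic2_at G u0 v0 -> (0 < eps)%R ->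
  exists d, (0 < d)%R /\ forall u v, (Cmod (u - u0) < d)%R -> (Cmod (v - v0) < d)%R ->
    (Cmod (G u v - G u0 v0) < eps)%R.
Proof.
  intros HG He. destruct (analytic2_at_rep G u0 v0 HG) as (r & B & Hr & HB).
  destruct (rep_cont r r B _ eps Hr Hr HB He) as (d & Hd & Hc).
  exists d. split; [exact Hd|]. intros u v Hu Hv. specialize (Hc (u - u0) (v - v0) Hu Hv).
  cbv beta in Hc. assert (E : forall x y : C, x + (y - x) = y) by (intros; ring).
  rewrite !E, !Cplus_0_r in Hc. exact Hc.
Qed.

Lemma near2_Cmod u0 v0 (P : C -> C -> Prop) d : (0 < d)%R ->
  (forall u v, (Cmod (u - u0) < d)%R -> (Cmod (v - v0) < d)%R -> P u v) -> near2 u0 v0 P.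
Proof.
  intros Hd H.
  destruct (locally_Cmod u0 (fun u => (Cmod (u - u0) < d)%R) d Hd (fun _ h => h)) as [d1 H1].
  destruct (locally_Cmod v0 (fun v => (Cmod (v - v0) < d)%R) d Hd (fun _ h => h)) as [d2 H2].
  assert (Hm : (0 < Rmin d1 d2)%R) by (apply Rmin_glb_lt; apply cond_pos).
  exists (mkposreal _ Hm). intros [u v] [Hu Hv]. simpl in *. apply H.
  - apply H1. eapply ball_le; [|exact Hu]. apply Rmin_l.
  - apply H2. eapply ball_le; [|exact Hv]. apply Rmin_r.
Qed.

Lemma near2_Cmod_inv u0 v0 (P : C -> C -> Prop) : near2 u0 v0 P ->
  exists d, (0 < d)%R /\
    forall u v, (Cmod (u - u0) < d)%R -> (Cmod (v - v0) < d)%R -> P u v.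
Proof.
  intros [d Hd]. exists d. split; [apply cond_pos|]. intros u v Hu Hv.
  apply (Hd (u, v)). split; simpl; now apply C_NormedModule_mixin_compat1.
Qed.

Lemma C_punctured (d : R) (p : C) : (0 < d)%R -> exists y, y <> p /\ (Cmod (y - p) < d)%R.
Proof.
  intros Hd. exists (p + RtoC (d / 2)). split.
  - intros E. assert (E' : RtoC (d / 2) = 0).
    { replace (RtoC (d / 2)) with (p + RtoC (d / 2) - p) by ring. rewrite E. ring. }
    apply RtoC_inj in E'. lra.
  - replace (p + RtoC (d / 2) - p) with (RtoC (d / 2)) by ring. rewrite Cmod_RtoC_pos; lra.
Qed.

(** Restores a point lost to a division: the zero e = ep(z) when e - ep(z) is cancelled from two
    factorizations, or the centre of a putative pole. *)
Lemma eq_of_cont (F G : C -> C) (p : C) :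
  (forall eps, (0 < eps)%R -> exists d, (0 < d)%R /\
    forall y, (Cmod (y - p) < d)%R -> (Cmod (F y - F p) < eps)%R) ->
  (forall eps, (0 < eps)%R -> exists d, (0 < d)%R /\
    forall y, (Cmod (y - p) < d)%R -> (Cmod (G y - G p) < eps)%R) ->
  (exists d, (0 < d)%R /\ forall y, (Cmod (y - p) < d)%R -> y <> p -> F y = G y) ->
  F p = G p.
Proof.
  intros HF HG (d0 & Hd0 & E).
  destruct (Ceq_dec (F p) (G p)) as [E'|E']; [exact E'|exfalso].
  assert (Hp : (0 < Cmod (F p - G p))%R).
  { apply Cmod_gt_0. intros Z. apply E'. replace (F p) with (F p - G p + G p) by ring.
    rewrite Z. ring. }
  destruct (HF (Cmod (F p - G p) / 2)%R ltac:(lra)) as (d1 & Hd1 & H1).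
  destruct (HG (Cmod (F p - G p) / 2)%R ltac:(lra)) as (d2 & Hd2 & H2).
  destruct (C_punctured (Rmin d0 (Rmin d1 d2)) p) as (y & Hy & Hyd).
  { repeat apply Rmin_glb_lt; assumption. }
  assert (T1 := Rmin_l d0 (Rmin d1 d2)). assert (T2 := Rmin_r d0 (Rmin d1 d2)).
  assert (T3 := Rmin_l d1 d2). assert (T4 := Rmin_r d1 d2).
  specialize (H1 y ltac:(lra)). specialize (H2 y ltac:(lra)).
  rewrite (E y ltac:(lra) Hy) in H1.
  assert (T := Cmod_sub_le (F p) (G y) (G p)). rewrite (Cmod_sub_sym (F p) (G y)) in T. lra.
Qed.

(** Keeps the pole away from eps = 0, where the formula for r_{2l} may divide by 0. *)
Lemma eps_res_neq_0 l (eb : C) : (1 <= l)%nat -> eb <> 0 -> eps_res l eb <> 0.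
Proof.
  intros Hl Heb. assert (Hl0 := INR_neq_0C l Hl). unfold eps_res. intros E.
  assert (Hl1 : INR l + 1 <> 0).
  { rewrite <- RtoC_plus. intros E'. apply RtoC_inj in E'. assert (T := pos_INR l). lra. }
  apply Heb. replace eb with (- - ((INR l + 1) / INR l * eb) * (INR l / (INR l + 1)))
    by (field; auto).
  rewrite E. ring.
Qed.

(** * Factorization, its uniqueness, and the pole of the Mie coefficient *)

Theorem mainTheorem3 :
  forall (l : nat) (eb : C),
    (1 <= l)%nat ->
    ~ (Im eb = 0%R /\ (Re eb <= 0)%R) ->
    (0 <= Im eb)%R ->
    let e0 := eps_res l eb in
    let f := mie_f l eb in
    (forall e z : C, analytic2_at f e z) /\
    (forall e z : C, e <> 0 -> z <> 0 -> f e z <> 0 ->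
       mie_r2 l eb e z =
         (2 * INR l + 1) / INR l
         * (Csqrt eb ^ (l + 1) / Csqrt e ^ (l - 1)) * (1 / f e z)) /\
    exists (ep : C -> C) (A : C -> C -> C),
      mie_factorization l eb ep A /\
      (forall (ep' : C -> C) (A' : C -> C -> C),
         mie_factorization l eb ep' A' ->
         locally (0 : C) (fun z => ep' z = ep z) /\
         near2 e0 0 (fun e z => A' e z = A e z)) /\
      (* the pole, locally unique for each small z *)
      (exists eta delta : posreal,
         forall z : C, Cmod z < delta ->
           Cmod (ep z - e0) < eta /\
           simple_zero (fun e => f e z) (ep z) /\
           (forall e : C, Cmod (e - e0) < eta -> f e z = 0 -> e = ep z) /\
           (* the factor sqrt(e)^(l-1), nonzero at e = ep z, makes r_{2l}
              single-valued across the branch cut of the square root *)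
           (z <> 0 ->
            simple_pole (fun e => Csqrt e ^ (l - 1) * mie_r2 l eb e z) (ep z) /\
            (forall e : C, Cmod (e - e0) < eta ->
               simple_pole (fun e' => Csqrt e' ^ (l - 1) * mie_r2 l eb e' z) e ->
               e = ep z))) /\
      (* the pole, characterized by its limit *)
      filterlim ep (locally (0 : C)) (locally e0) /\
      (forall q : C -> C,
         filterlim q (locally' (0 : C)) (locally e0) ->
         locally' (0 : C) (fun z => f (q z) z = 0) ->
         locally' (0 : C) (fun z => q z = ep z)).
Proof.
  intros l eb Hl Hcut _ e0 f.
  assert (Heb : eb <> 0) by (intros ->; apply Hcut; simpl; split; lra).
  assert (He0 : e0 <> 0) by now apply eps_res_neq_0.
  assert (Hent : entire2 f) by now apply entire2_mie_f.
  assert (Hr2 : forall e z : C, e <> 0 -> z <> 0 -> f e z <> 0 ->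
    mie_r2 l eb e z = (2 * INR l + 1) / INR l
      * (Csqrt eb ^ (l + 1) / Csqrt e ^ (l - 1)) * (1 / f e z))
    by (intros; now apply mie_r2_red).
  split; [intros; now apply entire2_analytic|]. split; [exact Hr2|].
  assert (Hxy : forall x y : C, x + (y - x) = y) by (intros; ring).
  assert (HF : entire2 (fun u v => f (e0 + u) v)).
  { apply (entire2_comp f (fun u _ => e0 + u) (fun _ v => v) Hent); [|apply entire2_snd].
    apply entire2_plus; [apply entire2_const|apply entire2_fst]. }
  destruct (HF 1%R ltac:(lra)) as [BF HBF].
  destruct (linear_factorization 1 1 BF _ ltac:(lra) ltac:(lra) HBF)
    as (p & q & g & A & Bg & BA & BI & Hp & Hq & Hg & HA & HI & Hg0 & HA1 & HFA).
  { intros u _. unfold f. rewrite mie_f_at_0 by exact Hl. fold e0. ring. }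
  set (ep := fun z => e0 + g z). set (Ae := fun e z => A (e - e0) z).
  assert (Hfact : forall e z, (Cmod (e - e0) <= p)%R -> (Cmod z <= q)%R ->
    Ae e z <> 0 /\ f e z = Ae e z * (e - ep z)).
  { intros e z He Hz. destruct (HFA (e - e0) z He Hz) as [H1 H2]. rewrite Hxy in H2.
    split; [exact H1|]. rewrite H2. unfold Ae, ep. ring. }
  assert (Hepz : forall z, ep z - e0 = g z) by (intros; unfold ep; ring).
  assert (Hep0 : ep 0 = e0) by (unfold ep; rewrite Hg0; ring).
  assert (HAan : forall e z, (Cmod (e - e0) < p)%R -> (Cmod z < q)%R -> analytic2_at Ae e z).
  { intros e z He Hz.
    apply (rep_analytic2 _ _ _ (p - Cmod (e - e0)) (q - Cmod z) BA); [lra|lra|].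
    apply (rep_ext _ _ _ (fun u v => A (e - e0 + u) (z + v))).
    - apply (rep_translate p q); [lra|lra|exact HA|lra|lra].
    - intros u v _ _. unfold Ae. f_equal. ring. }
  assert (Hgc : forall eps, (0 < eps)%R -> exists d, (0 < d)%R /\
    forall z, (Cmod z < d)%R -> (Cmod (g z) < eps)%R).
  { intros eps Heps. destruct (rep_cont p q Bg _ eps ltac:(lra) ltac:(lra) Hg Heps)
      as (d & Hd & Hc). exists d. split; [exact Hd|]. intros z Hz.
    specialize (Hc 0 z). rewrite Cmod_0, Hg0 in Hc. specialize (Hc Hd Hz).
    replace (g z - 0) with (g z) in Hc by ring. exact Hc. }
  assert (H0z : forall z : C, z - 0 = z) by (intros; ring).
  exists ep, Ae. split; [|split; [|split; [|split]]].
  - split; [|split; [exact Hep0|split; [|split]]].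
    + apply (locally_Cmod 0 _ q ltac:(lra)). intros z Hz. rewrite H0z in Hz.
      apply (rep_analytic1 _ _ p (q - Cmod z) (Cmod e0 + Bg)); [lra|lra|].
      apply (rep_plus _ _ _ _ (fun _ _ => e0) (fun _ v => g (z + v))).
      * apply rep_const; lra.
      * apply (rep_translate p q Bg (fun _ v => g v) 0 z); [lra|lra|exact Hg| |lra].
        rewrite Cmod_0. lra.
    + apply (near2_Cmod _ _ _ (Rmin p q)); [apply Rmin_glb_lt; lra|]. intros e z He Hz.
      assert (T1 := Rmin_l p q). assert (T2 := Rmin_r p q). rewrite H0z in Hz.
      apply HAan; fold e0 in He; lra.
    + apply (locally_Cmod _ _ p ltac:(lra)). intros e He. apply HA1. fold e0 in He. lra.
    + apply (near2_Cmod _ _ _ (Rmin p q)); [apply Rmin_glb_lt; lra|]. intros e z He Hz.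
      assert (T1 := Rmin_l p q). assert (T2 := Rmin_r p q). rewrite H0z in Hz. fold e0 in He.
      apply Hfact; lra.
  - intros ep' A' (_ & _ & HA'an & HA'1 & Hf').
    fold e0 in HA'an, HA'1, Hf'.
    apply near2_Cmod_inv in HA'an. destruct HA'an as (d1 & Hd1 & HA'an).
    apply near2_Cmod_inv in Hf'. destruct Hf' as (d2 & Hd2 & Hf').
    apply locally_singleton in HA'1.
    assert (HA'0 : analytic2_at A' e0 0).
    { apply HA'an; unfold Cminus; rewrite Cplus_opp_r, Cmod_0; lra. }
    (* Tolerance 1 is what keeps [A'], equal to 1 at the centre, from vanishing nearby. *)
    destruct (analytic2_at_cont A' e0 0 1 HA'0 ltac:(lra)) as (d3 & Hd3 & HA'c).
    set (d := Rmin (Rmin d1 d2) (Rmin d3 (Rmin p q))).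
    assert (Hd : (0 < d)%R) by (repeat apply Rmin_glb_lt; lra).
    assert (Hdle : (d <= d1 /\ d <= d2 /\ d <= d3 /\ d <= p /\ d <= q)%R).
    { unfold d. repeat split; unfold Rmin; repeat destruct (Rle_dec _ _); lra. }
    clearbody d. destruct (Hgc d Hd) as (dg & Hdg & Hgd).
    (* For |z| < dg the root ep(z) lies within d of e0, so the second factorization may be evaluated
       at it. *)
    set (d' := Rmin d dg). assert (Hd' : (0 < d')%R) by now apply Rmin_glb_lt.
    assert (Hd'le : (d' <= d /\ d' <= dg)%R) by (split; [apply Rmin_l|apply Rmin_r]).
    clearbody d'.
    assert (HA'n : forall e z, (Cmod (e - e0) < d)%R -> (Cmod z < d)%R -> A' e z <> 0).
    { intros e z He Hz E. specialize (HA'c e z). rewrite H0z, E, HA'1 in HA'c.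
      specialize (HA'c ltac:(lra) ltac:(lra)).
      replace (0 - 1) with (- (1)) in HA'c by ring. rewrite Cmod_opp, Cmod_1 in HA'c. lra. }
    (* At e = ep(z) the first factorization gives f = 0, so A' (ep - ep') = 0 with A' nonzero. *)
    assert (Heq : forall z, (Cmod z < d')%R -> ep' z = ep z).
    { intros z Hz. assert (Hgz := Hgd z ltac:(lra)). rewrite <- Hepz in Hgz.
      assert (E1 := Hf' (ep z) z). rewrite H0z in E1.
      specialize (E1 ltac:(lra) ltac:(lra)).
      destruct (Hfact (ep z) z ltac:(lra) ltac:(lra)) as [_ E2]. unfold f in E2.
      rewrite E2 in E1. replace (ep z - ep z) with (RtoC 0) in E1 by ring.
      rewrite Cmult_0_r in E1.
      destruct (Ceq_dec (ep z - ep' z) 0) as [E|E].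
      - replace (ep' z) with (ep z - (ep z - ep' z)) by ring. rewrite E. ring.
      - exfalso. apply (Cmult_neq_0 (A' (ep z) z) (ep z - ep' z));
          [apply HA'n; lra|exact E|now symmetry]. }
    assert (HeqA : forall e z, (Cmod (e - e0) < d)%R -> (Cmod z < d')%R -> e <> ep z ->
      A' e z = Ae e z).
    { intros e z He Hz Hne.
      assert (E1 := Hf' e z). rewrite H0z in E1. specialize (E1 ltac:(lra) ltac:(lra)).
      destruct (Hfact e z ltac:(lra) ltac:(lra)) as [_ E2]. unfold f in E2.
      rewrite E2, (Heq z Hz) in E1.
      assert (Hn : e - ep z <> 0).
      { intros E. apply Hne. rewrite <- (Hxy (ep z) e), E. ring. }
      replace (A' e z) with (A' e z * (e - ep z) / (e - ep z)) by (field; exact Hn).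
      rewrite <- E1. field. exact Hn. }
    split.
    + apply (locally_Cmod 0 _ d' Hd'). intros z Hz. rewrite H0z in Hz. now apply Heq.
    + apply (near2_Cmod _ _ _ d' Hd'). intros e z He Hz. rewrite H0z in Hz.
      destruct (Ceq_dec e (ep z)) as [E|E]; [|apply HeqA; [lra|exact Hz|exact E]].
      assert (Hc1 : forall G, analytic2_at G e z -> forall eps, (0 < eps)%R ->
        exists d, (0 < d)%R /\ forall y, (Cmod (y - e) < d)%R ->
          (Cmod (G y z - G e z) < eps)%R).
      { intros G HG eps Heps. destruct (analytic2_at_cont G e z eps HG Heps) as (c & Hc & HGc).
        exists c. split; [exact Hc|]. intros y Hy. apply HGc; [exact Hy|].
        unfold Cminus. now rewrite Cplus_opp_r, Cmod_0. }
      apply (eq_of_cont (fun e => A' e z) (fun e => Ae e z) e).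
      * apply Hc1. apply HA'an; rewrite ?H0z; lra.
      * apply Hc1. apply HAan; lra.
      * exists (d - Cmod (e - e0))%R. split; [lra|]. intros y Hy Hye.
        apply HeqA; [|exact Hz|now rewrite <- E].
        assert (T := Cmod_sub_le y e e0). lra.
  - assert (He0p : (0 < Cmod e0)%R) by now apply Cmod_gt_0.
    (* [p] is for the factorization, |e0| excludes e = 0 from the disc. *)
    set (eta := Rmin p (Cmod e0)).
    assert (Heta : (0 < eta)%R) by (apply Rmin_glb_lt; lra).
    assert (Hep : (eta <= p)%R) by apply Rmin_l. assert (Hee : (eta <= Cmod e0)%R) by apply Rmin_r.
    clearbody eta.
    destruct (Hgc eta Heta) as (dg & Hdg & Hgd).
    set (delta := Rmin q dg). assert (Hdelta : (0 < delta)%R) by (apply Rmin_glb_lt; lra).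
    assert (Hdq : (delta <= q)%R) by apply Rmin_l. assert (Hddg : (delta <= dg)%R) by apply Rmin_r.
    clearbody delta.
    exists (mkposreal _ Heta), (mkposreal _ Hdelta). simpl. intros z Hz.
    assert (Hgz := Hgd z ltac:(lra)).
    assert (Hne : forall e, (Cmod (e - e0) < eta)%R -> e <> 0).
    { intros e He ->. replace (0 - e0) with (- e0) in He by ring. rewrite Cmod_opp in He. lra. }
    assert (Hz0 : forall e, (Cmod (e - e0) < eta)%R -> f e z = 0 -> e = ep z).
    { intros e He E. destruct (Hfact e z ltac:(lra) ltac:(lra)) as [H1 H2]. rewrite E in H2.
      destruct (Ceq_dec (e - ep z) 0) as [E'|E'].
      - rewrite <- (Hxy (ep z) e), E'. ring.
      - exfalso. apply (Cmult_neq_0 _ _ H1 E'). now symmetry. }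
    split; [now rewrite Hepz|].
    assert (Hepe : (Cmod (ep z - e0) < eta)%R) by now rewrite Hepz.
    destruct (Hfact (ep z) z ltac:(lra) ltac:(lra)) as [HAn Hfz].
    replace (ep z - ep z) with (RtoC 0) in Hfz by ring. rewrite Cmult_0_r in Hfz.
    split; [|split; [exact Hz0|]].
    (* With w = e - ep(z), f = A w, so the derivative at the zero is A there; dividing A by w once
       more leaves the remainder L w^2. *)
    + split; [exact Hfz|]. exists (Ae (ep z) z). split; [|exact HAn].
      set (r := (p - Cmod (g z))%R).
      assert (Hr : (0 < r)%R) by (unfold r; lra).
      assert (HAt : rep r (q - Cmod z) BA (fun u v => A (g z + u) (z + v))).
      { apply (rep_translate p q); [exact Hr|lra|exact HA|unfold r; lra|lra]. }
      destruct (rep_divide_u r (q - Cmod z) BA _ Hr ltac:(lra) HAt) as (L & HL & EL).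
      apply (is_derive_quadratic _ _ _ r (BA / r)%R Hr). intros w Hw.
      assert (T := Cmod_triangle (g z) w).
      assert (Ew : ep z + w - e0 = g z + w) by (unfold ep; ring).
      destruct (Hfact (ep z + w) z) as [_ E].
      { rewrite Ew. unfold r in Hw. lra. }
      { lra. }
      rewrite E, Hfz. unfold Ae. rewrite Ew, Hepz.
      assert (C0 : (Cmod 0 <= q - Cmod z)%R) by (rewrite Cmod_0; lra).
      assert (E1 := EL w 0 Hw C0). cbv beta in E1. rewrite !Cplus_0_r in E1. rewrite E1.
      replace ((A (g z) z + w * L w 0) * (ep z + w - ep z) - 0 - w * A (g z) z)
        with (L w 0 * w ^ 2) by ring.
      rewrite Cmod_mult, Cmod_pow. apply Rmult_le_compat_r; [apply pow_le, Cmod_ge_0|].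
      now apply (rep_bound _ _ _ _ w 0 HL).
    + intros Hznz.
      set (c0 := (2 * INR l + 1) / INR l * Csqrt eb ^ (l + 1)).
      assert (Hc0 : c0 <> 0).
      { unfold c0. apply Cmult_neq_0; [|now apply Cpow_nz, Csqrt_neq_0].
        intros E. apply (INR_2l1_neq_0C l).
        replace (2 * INR l + 1) with ((2 * INR l + 1) / INR l * INR l)
          by (field; now apply INR_neq_0C). rewrite E. ring. }
      (* The root of e cancels exactly and leaves c0 / f, which does not see the branch cut. *)
      assert (Hpole : forall e, (Cmod (e - e0) < eta)%R -> e <> ep z ->
        Csqrt e ^ (l - 1) * mie_r2 l eb e z = c0 / f e z).
      { intros e He Hneq. assert (Hfe : f e z <> 0) by (intros E; now apply Hneq, Hz0).
        rewrite (Hr2 e z (Hne e He) Hznz Hfe). unfold c0. field.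
        repeat split; first [exact Hfe|now apply INR_neq_0C|apply Cpow_nz, Csqrt_neq_0, Hne, He]. }
      split.
      * exists (fun e => c0 * / Ae e z). split; [|split].
        -- set (r := (p - Cmod (g z))%R).
           assert (Hr : (0 < r)%R) by (unfold r; lra).
           assert (HIt : rep r (q - Cmod z) BI (fun u v => / A (g z + u) (z + v))).
           { apply (rep_translate p q BI (fun u v => / A u v));
               [exact Hr|lra|exact HI|unfold r; lra|lra]. }
           apply (rep_analytic1 _ _ 1 r (Cmod c0 * BI)); [lra|exact Hr|].
           apply (rep_scal _ _ _ (fun _ v => / Ae (ep z + v) z)).
           apply (rep_ext _ _ _ (fun _ v => / A (g z + v) (z + 0))).
           ++ apply (rep_comp r (q - Cmod z) 1 r BI r (Cmod 0)
                (fun u v => / A (g z + u) (z + v)) (fun _ v => v) (fun _ _ => 0)); try lra.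
              ** exact HIt.
              ** apply rep_snd; lra.
              ** apply rep_const; lra.
              ** rewrite Cmod_0. lra.
           ++ intros u v _ _. unfold Ae, ep. do 2 f_equal; ring.
        -- apply Cmult_neq_0; [exact Hc0|]. intros E. assert (E1 := Cinv_r _ HAn).
           rewrite E, Cmult_0_r in E1. apply RtoC_inj in E1. lra.
        -- apply (locally_Cmod (ep z) _ (eta - Cmod (ep z - e0))); [lra|].
           intros y Hy Hyn. assert (T := Cmod_sub_le y (ep z) e0).
           rewrite (Hpole y ltac:(lra) Hyn).
           destruct (Hfact y z ltac:(lra) ltac:(lra)) as [H1 H2]. rewrite H2. field.
           assert (Hyn' : y - ep z <> 0)
             by (intros E; apply Hyn; rewrite <- (Hxy (ep z) y), E; apply Cplus_0_r).
           auto.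
      (* If e <> ep(z), then f(e, z) <> 0, while h f = (y - e) c0 on a punctured disc about e; by
         continuity h(e) f(e, z) = 0, against h(e) <> 0. *)
      * intros e He (h & Hh & Hhn & Hloc).
        destruct (Ceq_dec e (ep z)) as [E|E]; [exact E|exfalso]. apply Hhn.
        assert (Hfe : f e z <> 0) by (intros E'; now apply E, Hz0).
        apply locally_Cmod_inv in Hloc. destruct Hloc as (d & Hd & Hloc).
        destruct (analytic_at_rep h e Hh) as (s & B & Hs & HB).
        set (s' := Rmin 1 s). assert (Hs' : (0 < s')%R) by (apply Rmin_glb_lt; lra).
        assert (Hs1 : (s' <= 1)%R) by apply Rmin_l. assert (Hss : (s' <= s)%R) by apply Rmin_r.
        assert (Hfe1 : entire2 (fun _ v => f (e + v) z)).
        { apply (entire2_comp f (fun _ v => e + v) (fun _ _ => z) Hent); [|apply entire2_const].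
          apply entire2_plus; [apply entire2_const|apply entire2_snd]. }
        destruct (Hfe1 1%R ltac:(lra)) as [Bf HBf].
        apply (rep_le _ _ _ 1 s' B) in HB; [|lra..]. apply (rep_le _ _ _ 1 s' Bf) in HBf; [|lra..].
        assert (E0 : h e * f e z = (e - e) * c0).
        { apply (eq_of_cont (fun y => h y * f y z) (fun y => (y - e) * c0) e).
          - intros eps Heps. apply (rep_cont1 (fun y => h y * f y z) e s' (B * Bf)); [exact Hs'| |exact Heps].
            apply (rep_mult _ _ _ _ (fun _ v => h (e + v)) (fun _ v => f (e + v) z));
              [lra|exact Hs'|exact HB|exact HBf].
          - intros eps Heps. apply (rep_cont1 (fun y => (y - e) * c0) e 1 (1 * Cmod c0)); [lra| |exact Heps].
            apply (rep_ext _ _ _ (fun _ v => v * c0)).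
            + apply (rep_mult _ _ _ _ (fun _ v => v) (fun _ _ => c0));
                [lra|lra|apply rep_snd; lra|apply rep_const; lra].
            + intros u v _ _. ring.
          - assert (Hep' : (0 < Cmod (e - ep z))%R).
            { apply Cmod_gt_0. intros E'. apply E. rewrite <- (Hxy (ep z) e), E'. ring. }
            exists (Rmin d (Rmin (Cmod (e - ep z)) (eta - Cmod (e - e0)))).
            split; [repeat apply Rmin_glb_lt; lra|]. intros y Hy Hye.
            assert (T1 := Rmin_l d (Rmin (Cmod (e - ep z)) (eta - Cmod (e - e0)))).
            assert (T2 := Rmin_r d (Rmin (Cmod (e - ep z)) (eta - Cmod (e - e0)))).
            assert (T3 := Rmin_l (Cmod (e - ep z)) (eta - Cmod (e - e0))).
            assert (T4 := Rmin_r (Cmod (e - ep z)) (eta - Cmod (e - e0))).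
            assert (T5 := Cmod_sub_le y e e0).
            assert (Hyp : y <> ep z).
            { intros ->. rewrite (Cmod_sub_sym (ep z) e) in Hy. lra. }
            assert (E1 := Hloc y ltac:(lra) Hye). cbv beta in E1.
            rewrite (Hpole y ltac:(lra) Hyp) in E1.
            assert (Hfy : f y z <> 0) by (intros E'; apply Hyp, Hz0; [lra|exact E']).
            assert (Hne' : y - e <> 0).
            { intros E'. apply Hye. rewrite <- (Hxy e y), E'. ring. }
            replace (h y) with (h y / (y - e) * (y - e)) by (field; exact Hne').
            rewrite <- E1. field. exact Hfy. }
        destruct (Ceq_dec (h e) 0) as [E'|E']; [exact E'|exfalso].
        apply (Cmult_neq_0 _ _ E' Hfe). rewrite E0. ring.
  - intros P HP. apply locally_Cmod_inv in HP. destruct HP as (d & Hd & HP).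
    destruct (Hgc d Hd) as (dg & Hdg & Hgd).
    apply (locally_Cmod 0 _ dg Hdg). intros z Hz. rewrite H0z in Hz.
    apply HP. rewrite Hepz. now apply Hgd.
  - intros r Hr Hfr.
    (* The limit brings r(z) into the disc where [Ae] has no zero; there f = 0 leaves only r(z) =
       ep(z). *)
    assert (Hr' := Hr (fun e => (Cmod (e - e0) < p)%R)
      (locally_Cmod e0 _ p ltac:(lra) (fun _ h => h))).
    apply locally_Cmod_inv in Hr'. destruct Hr' as (d1 & Hd1 & H1).
    apply locally_Cmod_inv in Hfr. destruct Hfr as (d2 & Hd2 & H2).
    apply (locally_Cmod 0 _ (Rmin q (Rmin d1 d2))).
    { repeat apply Rmin_glb_lt; lra. }
    intros z Hz Hzn.
    assert (T1 := Rmin_l q (Rmin d1 d2)). assert (T2 := Rmin_r q (Rmin d1 d2)).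
    assert (T3 := Rmin_l d1 d2). assert (T4 := Rmin_r d1 d2).
    specialize (H1 z ltac:(lra) Hzn). specialize (H2 z ltac:(lra) Hzn). simpl in H1, H2.
    rewrite H0z in Hz.
    destruct (Hfact (r z) z ltac:(lra) ltac:(lra)) as [Ha Hb]. rewrite H2 in Hb.
    destruct (Ceq_dec (r z - ep z) 0) as [E|E].
    + rewrite <- (Hxy (ep z) (r z)), E. ring.
    + exfalso. apply (Cmult_neq_0 _ _ Ha E). now symmetry.
Qed.
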